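(* Suppose there exist an integer $m>2$ and an odd prime power $q$ such that $n=\frac{q^m-1}{q-1}$. Let $B$ be a set with $n$ elements and let $G$ be a subgroup of $\mathrm{Perm}(B)\cong\mathbf{S}_n$ that contains a subgroup isomorphic to $\mathrm{L}_m(q)=\mathrm{PSL}_m(\mathbb{F}_q)$. Then the $G$-module $Q_B$ is very simple.
   Context: For a finite set $B$ with $n\ge 5$ elements, $\mathbb{F}_2^B$ denotes the $\mathbb{F}_2$-vector space of maps $h:B\to\mathbb{F}_2$, with $\mathrm{Perm}(B)$ acting by $(sh)(b)=h(s^{-1}(b))$. Let $(\mathbb{F}_2^B)^0=\{h:\sum_{b\in B}h(b)=0\}$ and $1_B$ the constant function $1$. If $n$ is even, $Q_B:=(\mathbb{F}_2^B)^0/(\mathbb{F}_2\cdot 1_B)$; if $n$ is odd, $Q_B:=(\mathbb{F}_2^B)^0$; it is a $G$-module for any subgroup $G\subset\mathrm{Perm}(B)$. A representation $\rho:G\to\mathrm{Aut}_{\mathbf F}(V)$ of a group $G$ on a vector space $V$ over a field $\mathbf F$ is called very simple if whenever $R\subset\mathrm{End}_{\mathbf F}(V)$ is an $\mathbf F$-subalgebra containing the identity with $\rho(\sigma)R\rho(\sigma)^{-1}\subset R$ for all $\sigma\in G$, then either $R=\mathbf F\cdot\mathrm{Id}$ or $R=\mathrm{End}_{\mathbf F}(V)$. *)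

(* Defs.v *)
From HB Require Import structures.
From mathcomp Require Import all_boot all_order all_algebra all_fingroup all_solvable.
From mathcomp Require Import all_field all_character.

Set Implicit Arguments.
Unset Strict Implicit.
Unset Printing Implicit Defensive.

Import GroupScope GRing.Theory.
Local Open Scope ring_scope.

(* We work in {'GL_m[F]} (matrices of size m.-1.+1, i.e. m for m>0). *)

Definition SL_set (m : nat) (F : finFieldType) : {set {'GL_m[F]}} :=
  [set g : {'GL_m[F]} | \det (GLval g) == 1].

Lemma SL_group_set (m : nat) (F : finFieldType) : group_set (SL_set m F).
Proof.
apply/group_setP; split; first by rewrite inE GL_1E det1.
move=> x y; rewrite !inE GL_MxE det_mulmx => /eqP -> /eqP ->.
by rewrite mulr1.
Qed.

Canonical SL_group (m : nat) (F : finFieldType) := group (SL_group_set m F).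

Definition SL (m : nat) (F : finFieldType) : {group {'GL_m[F]}} := SL_group m F.

Definition PSL (m : nat) (F : finFieldType) :=
  (SL m F / 'Z(SL m F))%g.

Definition very_simple (F : fieldType) (gT : finGroupType) (G : {set gT})
    (d : nat) (r : gT -> 'M[F]_d) : Prop :=
  forall R : 'M[F]_d -> Prop,
    R 1%:M ->
    (forall A B, R A -> R B -> R (A + B)) ->
    (forall (a : F) A, R A -> R (a *: A)) ->
    (forall A B, R A -> R B -> R (A *m B)) ->
    (forall g A, g \in G -> R A -> R (r g *m A *m invmx (r g))) ->
    (forall A, R A <-> exists a : F, A = a%:M) \/ (forall A, R A).

(* A function h : B -> F_2 is the row vector indexed by enum_rank.    *)

Section QB.
Variable B : finType.

(* (s h)(b) = h (s^-1 b), as the right action h |-> h *m permmx s      *)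
(* (with MathComp's convention (s * t) x = t (s x)).                 *)
Definition permmx (s : {perm B}) : 'M['F_2]_#|B| :=
  \matrix_(i, j) ((s (enum_val i) == enum_val j)%:R).

Definition sum0_mx : 'M['F_2]_#|B| := kermx (const_mx 1 : 'M['F_2]_(#|B|, 1)).

Definition ones_B : 'rV['F_2]_#|B| := const_mx 1.

(* action on (F_2^B)^0, the submodule representation (MathComp's
   submod_mx formula) *)
Definition rep_sum0 (s : {perm B}) : 'M['F_2]_(\rank sum0_mx) :=
  in_submod sum0_mx (val_submod (U := sum0_mx) 1%:M *m permmx s).

(* the line F_2 1_B inside (F_2^B)^0 (meaningful when #|B| is even),
   as a square matrix with that row space *)
Definition ones_in_sum0 : 'M['F_2]_(\rank sum0_mx) :=
  <<in_submod sum0_mx ones_B>>%MS.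

(* action on (F_2^B)^0 / F_2 1_B, the factor-module representation
   (MathComp's factmod_mx formula) *)
Definition rep_sum0_mod1 (s : {perm B}) :
    'M['F_2]_(\rank (cokermx ones_in_sum0)) :=
  in_factmod ones_in_sum0 (val_factmod (U := ones_in_sum0) 1%:M *m rep_sum0 s).

Definition QB_very_simple (G : {set {perm B}}) : Prop :=
  if odd #|B| then very_simple G rep_sum0 else very_simple G rep_sum0_mod1.

End QB.

(* Main.v *)
(* Write S = SL_m(F), k = m - 1, Q = q^k, r = (Q - 1)/(q - 1), so that n = q r + 1; all actions of
   PSL_m(F) are seen as actions of S.  Let E = {tau v} be the elementary abelian subgroup of order Q
   of transvections sharing one hyperplane; the complement lam g, g in SL_k(F), permutes its
   nontrivial characters transitively.

   - Representations: over an extension of F_2 with a p-th root of unity, the projectors of the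
     nontrivial characters of E are conjugate, hence have the same rank.  A nontrivial
     representation in characteristic 2 thus has degree >= Q - 1; on F_2^B (after transitivity) all
     these ranks are 1, which determines the submodules of F_2^B and the centralizer of S on Q_B.
   - Actions: if S acts nontrivially on a set X, then |X| >= n.  The same equality of multiplicities,
     for the permutation character, shows that if |X| < n then either every E-stabilizer of a point
     is a hyperplane, or every point is E-fixed or has a trivial E-stabilizer; relations between
     transvections refute both.
   - Very simplicity: let R be normalized by S and let U be the group of units of R.  By the bound on
     actions Q_B is U-isotypic.  The centre of the span of U is F_2, since the perfect group S
     centralizes its cyclic group of units.  Hence conjugation by S is implemented on a simple
     U-submodule M of Q_B by a representation of S on M.  If that is trivial, U commutes with S and
     U = 1; otherwise dim M > dim Q_B / 2, so M = Q_B and R is everything.  If U = 1, then R is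
     Boolean, S permutes its at most dim Q_B < n atoms, hence fixes them, and R is scalar. *)

Require Import Defs.
From HB Require Import structures.
From mathcomp Require Import all_boot all_order all_algebra all_fingroup all_solvable.
From mathcomp Require Import all_field all_character.
From mathcomp Require Import zify ring.
From Stdlib Require Import ClassicalEpsilon.

Set Implicit Arguments.
Unset Strict Implicit.
Unset Printing Implicit Defensive.

Import Order.TTheory GroupScope GRing.Theory Num.Theory.
Local Open Scope ring_scope.

(** * Transvections *)

Section Transvections.

Variable F : fieldType.

(** A row outside the row space of [U] has a nonzero image under the cokernel matrix; the column of
    that matrix at a nonzero coordinate of the image, rescaled, is the required linear form. *)
Lemma separating_col m n (U : 'M[F]_(m, n)) (v : 'rV[F]_n) :
  ~~ (v <= U)%MS -> exists2 c : 'cV[F]_n, U *m c = 0 & v *m c = 1%:M.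
Proof.
rewrite submxE; move: (cokermx U) (mulmx_coker U) => C UC /rowV0Pn [w].
case/submxP => b -> nz0.
have [j nz | v0] := pickP [pred j | (v *m C) 0 j != 0]; last first.
  case/eqP: nz0; suff -> : v *m C = 0 by rewrite mulmx0.
  by apply/rowP => j; have /negbFE/eqP -> := v0 j; rewrite mxE.
exists (((v *m C) 0 j)^-1 *: col j C).
  by rewrite -scalemxAr colE mulmxA UC mul0mx scaler0.
rewrite -scalemxAr colE mulmxA -colE; move: (v *m C) nz => x /= nz.
by apply/matrixP=> a c; rewrite !ord1 !mxE mulVf.
Qed.

Lemma separating_row n r (U : 'M[F]_(n, r)) (v : 'cV[F]_n) :
  ~~ (v^T <= U^T)%MS -> exists2 phi : 'rV[F]_n, phi *m U = 0 & phi *m v = 1%:M.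
Proof.
case/separating_col => c Uc vc; exists c^T; apply: trmx_inj.
  by rewrite trmx_mul trmxK Uc trmx0.
by rewrite trmx_mul trmxK vc trmx1.
Qed.

Lemma dual_col n (v : 'cV[F]_n) : v != 0 -> exists phi : 'rV[F]_n, phi *m v = 1%:M.
Proof.
move=> nz; have [|phi _ h] := @separating_row n 1 0 v; last by exists phi.
by rewrite trmx0 eqmx0 submx0 -trmx0 (inj_eq trmx_inj).
Qed.

(** The map [x |-> x + phi(x) u] on columns. The condition [phi *m u = 0] is carried by the
    lemmas. *)
Definition transvection n (u : 'cV[F]_n) (phi : 'rV[F]_n) : 'M[F]_n := 1%:M + u *m phi.

Lemma transvectionD n (u w : 'cV[F]_n) (phi : 'rV[F]_n) :
  phi *m w = 0 -> transvection u phi *m transvection w phi = transvection (u + w) phi.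
Proof.
move=> h; rewrite /transvection mulmxDl mul1mx -addrA; congr (_ + _).
by rewrite mulmxDr mulmx1 -!mulmxA (mulmxA phi) h mul0mx mulmx0 addr0 mulmxDl addrC.
Qed.

Lemma transvectionDr n (u : 'cV[F]_n) (phi psi : 'rV[F]_n) :
  phi *m u = 0 -> transvection u phi *m transvection u psi = transvection u (phi + psi).
Proof.
move=> h; rewrite /transvection mulmxDl mul1mx -addrA; congr (_ + _).
by rewrite mulmxDr mulmx1 -!mulmxA (mulmxA phi) h mul0mx mulmx0 addr0 mulmxDr addrC.
Qed.

Lemma transvection0 n (phi : 'rV[F]_n) : transvection 0 phi = 1%:M.
Proof. by rewrite /transvection mul0mx addr0. Qed.

Lemma transvection0r n (u : 'cV[F]_n) : transvection u 0 = 1%:M.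
Proof. by rewrite /transvection mulmx0 addr0. Qed.

Lemma transvectionZ n (u : 'cV[F]_n) (phi : 'rV[F]_n) a :
  transvection (a *: u) phi = transvection u (a *: phi).
Proof. by rewrite /transvection -scalemxAl -scalemxAr. Qed.

Lemma transvection_unit n (u : 'cV[F]_n) (phi : 'rV[F]_n) :
  phi *m u = 0 -> transvection u phi *m transvection (- u) phi = 1%:M.
Proof. by move=> h; rewrite transvectionD ?subrr ?transvection0 // mulmxN h oppr0. Qed.

Inductive transvection_prod n : 'M[F]_n -> Prop :=
| TransvectionProd1 : transvection_prod 1%:M
| TransvectionProdM u phi A : phi *m u = 0 -> transvection_prod A ->
    transvection_prod (transvection u phi *m A).

Lemma transvection_prod_tv n (u : 'cV[F]_n) (phi : 'rV[F]_n) :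
  phi *m u = 0 -> transvection_prod (transvection u phi).
Proof.
by move=> h; rewrite -[transvection _ _]mulmx1; apply: TransvectionProdM => //; left.
Qed.

Lemma transvection_prodM n (A B : 'M[F]_n) :
  transvection_prod A -> transvection_prod B -> transvection_prod (A *m B).
Proof.
elim=> [|u phi {}A h _ IH] pB; first by rewrite mul1mx.
by rewrite -mulmxA; apply: TransvectionProdM => //; apply: IH.
Qed.

Lemma transvection_prodV n (A : 'M[F]_n) : transvection_prod A ->
  exists2 B, transvection_prod B & B *m A = 1%:M.
Proof.
elim=> [|u phi {}A h _ [B pB BA]]; first by exists 1%:M; rewrite ?mulmx1 //; left.
exists (B *m transvection (- u) phi).
  by apply: transvection_prodM => //; apply: transvection_prod_tv; rewrite mulmxN h oppr0.
rewrite -mulmxA (mulmxA (transvection _ _)) transvectionD // addrC subrr.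
by rewrite transvection0 mul1mx.
Qed.

(** The transvection with centre [w - u] along a form that vanishes on [w - u] and is 1 on [u] takes
    [u] to [w]; the form exists because [u] is not a multiple of [w - u]. *)
Lemma transvection_prod_col_indep n (u w : 'cV[F]_n) :
  ~~ (u^T <= w^T)%MS -> w != 0 -> exists2 A, transvection_prod A & A *m u = w.
Proof.
move=> uw w0.
have [|phi p1 p2] := @separating_row n 1 (w - u) u.
  apply: contra uw => /sub_rVP [a e].
  have ea : (1 + a) *: u = a *: w.
    apply: trmx_inj; rewrite !linearZ /= scalerDl scale1r {1}e.
    by rewrite linearB /= scalerBr subrK.
  have [a0|na] := eqVneq (1 + a) 0.
    move: ea; rewrite a0 scale0r => /esym /eqP; rewrite scaler_eq0 (negbTE w0) orbF.
    by move=> /eqP a0'; move: a0; rewrite a0' addr0 => /eqP; rewrite oner_eq0.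
  apply/sub_rVP; exists ((1 + a)^-1 * a); rewrite -linearZ /= -scalerA -ea scalerA.
  by rewrite mulVf // scale1r.
exists (transvection (w - u) phi); first exact: transvection_prod_tv.
by rewrite /transvection mulmxDl mul1mx -mulmxA p2 mulmx1 addrC subrK.
Qed.

Lemma exists_not_multiple n (u : 'cV[F]_n) : (1 < n)%N -> exists y : 'cV[F]_n, ~~ (y^T <= u^T)%MS.
Proof.
move=> n1; have : ~~ (1%:M <= u^T)%MS.
  apply/negP => /mxrankS; rewrite mxrank1 => h.
  by have := leq_trans n1 (leq_trans h (rank_leq_row _)).
by case/row_subPn => i h; exists (row i 1%:M)^T; rewrite trmxK.
Qed.

(** Two proportional columns are joined through a column [y] independent of both. *)
Lemma transvection_prod_col n (u w : 'cV[F]_n) : (1 < n)%N -> u != 0 -> w != 0 ->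
  exists2 A, transvection_prod A & A *m u = w.
Proof.
move=> n1 u0 w0; have [uw|uw] := boolP (u^T <= w^T)%MS; last first.
  exact: transvection_prod_col_indep.
have [y yu] := exists_not_multiple u n1.
have y0 : y != 0 by apply: contraNneq yu => ->; rewrite trmx0 sub0mx.
have yw : ~~ (y^T <= w^T)%MS.
  apply: contra yu => yw; apply: submx_trans yw _.
  have /eqmxP/eqmx_sym/eqmxP/andP[] // : (u^T == w^T)%MS.
  have r1 (x : 'cV[F]_n) : x != 0 -> \rank x^T = 1%N.
    by move=> x0; rewrite rank_rV -trmx0 (inj_eq trmx_inj) x0.
  by rewrite -mxrank_leqif_eq // !r1.
have uy : ~~ (u^T <= y^T)%MS.
  apply: contra yu => /sub_rVP [a e]; apply/sub_rVP; exists a^-1.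
  rewrite e scalerA mulVf ?scale1r //; apply: contra_neq u0 => a0.
  by apply: trmx_inj; rewrite e a0 scale0r trmx0.
have [A pA Au] := transvection_prod_col_indep uy y0.
have [B pB By] := transvection_prod_col_indep yw w0.
exists (B *m A); first exact: transvection_prodM.
by rewrite -mulmxA Au.
Qed.

Lemma block_diag_transvection n (u : 'cV[F]_n) (phi : 'rV[F]_n) :
  block_mx (1%:M : 'M_1) 0 0 (transvection u phi) =
  transvection (col_mx (0 : 'M_1) u) (row_mx (0 : 'M_1) phi).
Proof.
rewrite /transvection mul_col_row !mulmx0 !mul0mx scalar_mx_block add_block_mx.
by rewrite !addr0.
Qed.

Lemma transvection_prod_block n (A : 'M[F]_n) : transvection_prod A ->
  transvection_prod (block_mx (1%:M : 'M_1) 0 0 A).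
Proof.
elim=> [|u phi {}A h _ IH]; first by rewrite -scalar_mx_block; left.
have -> : block_mx (1%:M : 'M_1) 0 0 (transvection u phi *m A) =
  block_mx (1%:M : 'M_1) 0 0 (transvection u phi) *m block_mx 1%:M 0 0 A.
  by rewrite mulmx_block !mulmx0 !mul0mx !addr0 mulmx1 add0r.
apply: transvection_prodM => //; rewrite block_diag_transvection.
by apply: transvection_prod_tv; rewrite mul_row_col h mulmx0 addr0.
Qed.

(** Matrix determinant lemma: two block eliminations bring the matrix with blocks [1], [- phi], [u],
    [1] to a triangular form, one with diagonal [1], [1 + u *m phi], the other with unit diagonal
    since [phi *m u = 0]. *)
Lemma det_transvection_prod n (A : 'M[F]_n) : transvection_prod A -> \det A = 1.
Proof.
elim=> [|u phi {}A h _ IH]; first by rewrite det1.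
rewrite det_mulmx IH mulr1.
have e' : block_mx 1%:M 0 (- u) (1%:M : 'M_n) *m block_mx 1%:M (- phi) u 1%:M =
   block_mx 1%:M (- phi) 0 (transvection u phi).
  rewrite mulmx_block !mul1mx !mul0mx !mulmx1 !addr0 addNr; congr block_mx.
  by rewrite mulNmx mulmxN opprK addrC.
have /(congr1 determinant) := e'; rewrite det_mulmx det_ublock !det_lblock !det1 !mul1r.
move=> <-; have e3 : block_mx 1%:M phi 0 (1%:M : 'M_n) *m block_mx 1%:M (- phi) u 1%:M =
   block_mx 1%:M 0 u 1%:M.
  by rewrite mulmx_block !mul1mx !mul0mx !mulmx1 h !add0r addr0 addNr.
by have /(congr1 determinant) := e3; rewrite det_mulmx det_ublock det_lblock !det1 !mul1r.
Qed.

Lemma det_transvection n (u : 'cV[F]_n) (phi : 'rV[F]_n) :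
  phi *m u = 0 -> \det (transvection u phi) = 1.
Proof. by move=> h; apply/det_transvection_prod/transvection_prod_tv. Qed.

(** A product of transvections takes the first column of [A] to the first basis vector. What
    remains, with blocks [1], [b], [0], [d], is a transvection centred at that vector times the
    block diagonal matrix of [d], to which the induction hypothesis applies. *)
Lemma SL_transvection_prod_step n (A : 'M[F]_(1 + n.+1)) :
  (forall B : 'M[F]_n.+1, \det B = 1 -> transvection_prod B) ->
  \det A = 1 -> transvection_prod A.
Proof.
move=> IH dA.
pose e0 : 'cV[F]_(1 + n.+1) := col_mx 1%:M 0.
have uA : A \in unitmx by rewrite unitmxE dA unitr1.
have nz0 : e0 != 0 by rewrite col_mx_eq0 negb_and -mxrank_eq0 mxrank1.
have nzA : A *m e0 != 0.
  by apply: contra_neq nz0 => h; rewrite -[e0](mulKmx uA) h mulmx0.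
have [B pB BA] := @transvection_prod_col (1 + n.+1) _ _ isT nzA nz0.
have [C pC CB] := transvection_prodV pB.
rewrite -[A]mul1mx -CB -mulmxA; apply: transvection_prodM => //.
have dBA : \det (B *m A) = 1 by rewrite det_mulmx dA (det_transvection_prod pB) mulr1.
move: (B *m A) dBA (mulmxA B A e0) => D dD; rewrite BA => /esym De {A dA uA nzA BA B pB C pC CB}.
rewrite -[D](@submxK _ 1 n.+1 1 n.+1) in De dD *.
move: (ulsubmx _) (ursubmx _) (dlsubmx _) (drsubmx _) De dD => a b c d.
rewrite [in X in X -> _]/e0 mul_block_col !mulmx1 !mulmx0 !addr0 => /eq_col_mx [-> ->].
rewrite det_ublock det1 mul1r => dd.
have ud : d \in unitmx by rewrite unitmxE dd unitr1.
have -> : block_mx 1%:M b 0 d =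
  block_mx 1%:M (b *m invmx d) 0 1%:M *m block_mx (1%:M : 'M_1) 0 0 d.
  by rewrite mulmx_block !mul1mx !mul0mx !mulmx0 !addr0 !add0r mulmxKV.
apply: transvection_prodM; last exact/transvection_prod_block/IH.
have -> : block_mx 1%:M (b *m invmx d) 0 1%:M =
   transvection e0 (row_mx 0 (b *m invmx d)).
  rewrite /transvection mul_col_row mul0mx mulmx0 scalar_mx_block add_block_mx.
  by rewrite !mul1mx !mul0mx !addr0 add0r.
by apply: transvection_prod_tv; rewrite mul_row_col mul0mx mulmx0 addr0.
Qed.

Theorem SL_transvection_prod n (A : 'M[F]_n) : \det A = 1 -> transvection_prod A.
Proof.
elim: n A => [|[|n] IH] A dA.
- by rewrite (flatmx0 A) -(flatmx0 1%:M); left.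
- suff -> : A = 1%:M by left.
  by apply/matrixP => i j; rewrite !ord1 -det_mx11 dA mxE eqxx.
exact: (@SL_transvection_prod_step n).
Qed.

Lemma SL_ind n (P : 'M[F]_n -> Prop) : P 1%:M ->
  (forall A B, \det A = 1 -> \det B = 1 -> P A -> P B -> P (A *m B)) ->
  (forall u phi, phi *m u = 0 -> P (transvection u phi)) ->
  forall A, \det A = 1 -> P A.
Proof.
move=> P1 PM Pt A /SL_transvection_prod; elim=> // u phi {}A h pA IH.
apply: PM => //; [exact: det_transvection | exact: det_transvection_prod | exact: Pt].
Qed.

Lemma SL_trans_col n (u w : 'cV[F]_n) : (1 < n)%N -> u != 0 -> w != 0 ->
  exists2 A : 'M_n, \det A = 1 & A *m u = w.
Proof.
move=> n1 u0 w0; have [A pA h] := transvection_prod_col n1 u0 w0.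
by exists A => //; apply: det_transvection_prod.
Qed.

Lemma SL_trans_row n (u w : 'rV[F]_n) : (1 < n)%N -> u != 0 -> w != 0 ->
  exists2 A : 'M_n, \det A = 1 & u *m A = w.
Proof.
move=> n1 u0 w0; have nz (x : 'rV[F]_n) : x != 0 -> x^T != 0.
  by apply: contra_neq => h; apply: trmx_inj; rewrite h trmx0.
have [A dA h] := SL_trans_col n1 (nz _ u0) (nz _ w0); exists A^T; first by rewrite det_tr.
by apply: trmx_inj; rewrite trmx_mul trmxK h.
Qed.

End Transvections.

(** * Additive characters and their projectors *)

Definition additive_char (F K : nzRingType) (psi : F -> K) :=
  [/\ psi 0 = 1, {morph psi : x y / x + y >-> x * y} & exists x, psi x != 1].

(** A coordinate of [F], seen as a vector space over its prime field, is used as the exponent of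
    [zeta]. *)
Lemma additive_char_exists (F : finFieldType) (K : fieldType) p (zeta : K) :
  p \in [pchar F] -> zeta ^+ p = 1 -> zeta != 1 ->
  exists psi : F -> K, additive_char psi.
Proof.
move=> pF zp z1; have pr_p := pcharf_prime pF.
have [f lin_f [g _ fK]] : vector_axiom_def (logn p #|F|) (pPrimeCharType pF).
  exact: pprimeChar_vectAxiom pF.
have fD x y : f (x + y) = f x + f y by have := lin_f 1 x y; rewrite !scale1r.
have [i _] : exists i : 'I_(logn p #|F|), true.
  have : (0 < logn p #|F|)%N.
    rewrite -(ltn_exp2l _ _ (prime_gt1 pr_p)) expn0 -(card_pprimeChar pF).
    exact: finNzRing_gt1.
  by case: (logn p #|F|) => // n _; exists ord0.
exists (fun x => zeta ^+ (f x 0 i : 'F_p)); split.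
- suff -> : f 0 = 0 by rewrite mxE expr0.
  by apply: (addIr (f 0)); rewrite -fD !add0r.
- move=> x y; rewrite fD mxE -exprD /= -[in RHS](expr_mod _ zp).
  by congr (_ ^+ (_ %% _)); apply: Fp_cast.
exists (g (delta_mx 0 i)); rewrite fK mxE !eqxx /=.
by rewrite modn_small ?expr1.
Qed.

(** Since [p] is odd, [X^p - 1] is separable over ['F_2]; its [p > 1] distinct roots in a splitting
    field cannot all be 1. *)
Lemma extension_F2_root p : prime p -> odd p ->
  exists (K : fieldType) (iota : {rmorphism 'F_2 -> K}) (zeta : K),
    zeta ^+ p = 1 /\ zeta != 1.
Proof.
move=> pr_p odd_p; have p_gt0 := prime_gt0 pr_p.
have nz : 'X^p - 1 != 0 :> {poly 'F_2} by rewrite monic_neq0 ?monicXnsubC.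
have [L [zs DqL _]] := FinSplittingFieldFor nz.
rewrite rmorphB rmorphXn /= map_polyX rmorph1 in DqL.
have [/hasP [z zsz z1]|/hasPn all1] := boolP (has (predC1 1) zs).
  exists L, (in_alg L), z; split=> //; apply/eqP; rewrite -subr_eq0.
  have : root ('X^p - 1) z by rewrite (eqp_root DqL) root_prod_XsubC.
  by rewrite rootE !hornerE.
have Uzs : uniq zs.
  rewrite -separable_prod_XsubC -(eqp_separable DqL) cyclotomic.separable_Xn_sub_1 //.
  have p2 : 2 \in [pchar L] by rewrite pchar_lalg pchar_Fp.
  by rewrite -(dvdn_pcharf p2) dvdn2 odd_p.
have := eqp_size DqL; rewrite size_prod_XsubC size_polyDl; last first.
  by rewrite size_polyXn size_polyN size_poly1 ltnS p_gt0.
rewrite size_polyXn => -[] sz; have : (size zs <= size [:: (1%R : L)])%N.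
  by apply: uniq_leq_size => // z /all1 /=; rewrite negbK inE.
by rewrite -sz leqNgt prime_gt1.
Qed.

Section Fourier.

Variables (F : finFieldType) (k : nat) (K : fieldType) (psi : F -> K).
Hypothesis psiP : additive_char psi.

(** Rows index the characters of the additive group of columns: [c] stands for
    [v |-> psi (dot c v)]. *)
Definition dot (c : 'rV[F]_k) (v : 'cV[F]_k) : F := (c *m v) 0 0.

Lemma dot0l v : dot 0 v = 0. Proof. by rewrite /dot mul0mx mxE. Qed.
Lemma dot0r c : dot c 0 = 0. Proof. by rewrite /dot mulmx0 mxE. Qed.
Lemma dotDl c d v : dot (c + d) v = dot c v + dot d v.
Proof. by rewrite /dot mulmxDl mxE. Qed.
Lemma dotDr c v w : dot c (v + w) = dot c v + dot c w.
Proof. by rewrite /dot mulmxDr mxE. Qed.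
Lemma dotNl c v : dot (- c) v = - dot c v.
Proof. by rewrite /dot mulNmx mxE. Qed.
Lemma dotNr c v : dot c (- v) = - dot c v.
Proof. by rewrite /dot mulmxN mxE. Qed.
Lemma dotZl a c v : dot (a *: c) v = a * dot c v.
Proof. by rewrite /dot -scalemxAl mxE. Qed.
Lemma dotZr a c v : dot c (a *: v) = a * dot c v.
Proof. by rewrite /dot -scalemxAr mxE. Qed.

Lemma dot_mulmx c (g : 'M_k) v : dot (c *m g) v = dot c (g *m v).
Proof. by rewrite /dot mulmxA. Qed.

Lemma dot_surjr c x : c != 0 -> exists v, dot c v = x.
Proof.
move=> nz; have [|u _ cu] := @separating_col F 0 k 0 c.
  by rewrite eqmx0 submx0.
by exists (x *: u); rewrite dotZr /dot cu mxE eqxx mulr1.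
Qed.

Lemma dot_surjl v x : v != 0 -> exists c, dot c v = x.
Proof.
move=> nz; have [u uv] := dual_col nz.
by exists (x *: u); rewrite dotZl /dot uv mxE eqxx mulr1.
Qed.

Let psi0 : psi 0 = 1. Proof. by case: psiP. Qed.
Let psiD : {morph psi : x y / x + y >-> x * y}. Proof. by case: psiP. Qed.

(** Orthogonality on a subgroup [D]: translation by an element where the character is not 1
    multiplies the sum by that value. *)
Lemma char_sum_set (D : {set 'cV[F]_k}) c : 
  {in D &, forall v w, v - w \in D} ->
  \sum_(v in D) psi (dot c v) = #|D|%:R *+ [forall v in D, psi (dot c v) == 1].
Proof.
move=> DB; case: (boolP [forall _ in _, _]) => [/forall_inP h | /forall_inPn [w Dw nw]].
  by rewrite (eq_bigr (fun _ => 1)) ?sumr_const ?mulr1n // => v /h /eqP.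
rewrite mulr0n; set s := \sum_(v in D) _.
suff e : s = psi (dot c w) * s.
  have [-> //|nz] := eqVneq s 0; case/eqP: nw; apply: (mulIf nz).
  by rewrite mul1r.
rewrite /s [in LHS](reindex_inj (addrI w)) mulr_sumr; apply: eq_big => v.
  have D0 : 0 \in D by rewrite -(subrr w) DB.
  apply/idP/idP => h; last by rewrite -[v]opprK DB // -sub0r DB.
  by have := DB _ _ h Dw; rewrite addrAC subrr add0r.
by rewrite dotDr psiD.
Qed.

Lemma char_sum_col c : \sum_v psi (dot c v) = (#|F| ^ k)%:R *+ (c == 0).
Proof.
have := @char_sum_set setT c (fun _ _ _ _ => in_setT _).
rewrite cardsT card_mx muln1 (eq_bigl xpredT) => [->|v]; last by rewrite inE.
congr (_ *+ nat_of_bool _); apply/forall_inP/eqP => [h | -> v _]; last first.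
  by rewrite dot0l psi0.
apply: contraTeq isT => nz; have [_ _ [x nx]] := psiP.
by have [v e] := dot_surjr x nz; have := h v (in_setT _); rewrite e (negbTE nx).
Qed.

Lemma char_sum_row v : \sum_c psi (dot c v) = (#|F| ^ k)%:R *+ (v == 0).
Proof.
have [-> | nz] := eqVneq v 0.
  under eq_bigr do rewrite dot0r psi0.
  by rewrite sumr_const card_mx mul1n.
have [_ _ [x nx]] := psiP; have [c0 e] := dot_surjl x nz.
rewrite mulr0n; set s := \sum_c _; have es : s = psi x * s.
  rewrite /s [in LHS](reindex_inj (addrI c0)) mulr_sumr; apply: eq_bigr => c _.
  by rewrite dotDl psiD e.
have [-> //|nzs] := eqVneq s 0; case/eqP: nx; apply: (mulIf nzs).
by rewrite mul1r.
Qed.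

End Fourier.

(** The row spaces are independent: [e i] is the identity on its own row space and kills the
    others. *)
Lemma orthogonal_idem_rank (K : fieldType) a (I : finType) (e : I -> 'M[K]_a) :
  (forall i j, e i *m e j = e i *+ (i == j)) -> (\sum_i \rank (e i) <= a)%N.
Proof.
move=> orth; suff /mxdirectP /= <- : mxdirect (\sum_i e i)%MS by exact: rank_leq_col.
apply/mxdirect_sumsP => i _; apply/eqP/rowV0P => v; rewrite sub_capmx => /andP[vi].
have h : (\sum_(j | true && (j != i)) e j <= kermx (e i))%MS.
  apply/sumsmx_subP => j /= ne; apply/sub_kermxP.
  by rewrite orth (negbTE ne) mulr0n.
move=> /submx_trans /(_ h) /sub_kermxP; have /submxP [w ->] := vi.
by rewrite -mulmxA orth eqxx mulr1n.
Qed.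

Section Projectors.

Variables (F : finFieldType) (k : nat) (K : fieldType) (psi : F -> K) (a : nat).
Variable X : 'cV[F]_k -> 'M[K]_a.
Hypotheses (psiP : additive_char psi) (card1 : (#|F| ^ k)%:R = 1 :> K).
Hypotheses (X0 : X 0 = 1%:M) (XD : forall v w, X (v + w) = X v *m X w).

(** The projector onto the part where [X v] acts as [psi (dot c v)]; the usual normalizing factor is
    1, by [card1]. *)
Definition char_proj c : 'M[K]_a := \sum_v psi (- dot c v) *: X v.

Let psi0 : psi 0 = 1. Proof. by case: psiP. Qed.
Let psiD : {morph psi : x y / x + y >-> x * y}. Proof. by case: psiP. Qed.

Lemma char_proj_actl w c : X w *m char_proj c = psi (dot c w) *: char_proj c.
Proof.
rewrite /char_proj mulmx_sumr scaler_sumr [in RHS](reindex_inj (addrI w)).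
apply: eq_bigr => v _; rewrite -scalemxAr -XD scalerA -psiD dotDr opprD addrA subrr.
by rewrite add0r.
Qed.

Lemma char_proj_actr w c : char_proj c *m X w = psi (dot c w) *: char_proj c.
Proof.
rewrite -char_proj_actl /char_proj mulmx_sumr mulmx_suml; apply: eq_bigr => v _.
by rewrite -scalemxAr -scalemxAl -!XD addrC.
Qed.

Lemma char_proj_orth c d : char_proj c *m char_proj d = char_proj c *+ (c == d).
Proof.
have -> : char_proj c *m char_proj d = \sum_v psi (dot (d - c) v) *: char_proj d.
  rewrite {1}/char_proj mulmx_suml; apply: eq_bigr => v _.
  by rewrite -scalemxAl char_proj_actl scalerA -psiD dotDl dotNl addrC.
rewrite -scaler_suml char_sum_col // card1 subr_eq0 eq_sym.
by case: eqP => [->|_]; rewrite ?scale1r ?scale0r.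
Qed.

Lemma char_proj_sum : \sum_c char_proj c = 1%:M.
Proof.
rewrite exchange_big (bigD1 0) //= [X in _ + X]big1 => [|v nz].
  rewrite addr0 X0 -scaler_suml; under eq_bigr do rewrite dot0r oppr0 psi0.
  by rewrite sumr_const card_mx mul1n card1 scale1r.
rewrite -scaler_suml; under eq_bigr do rewrite -dotNr.
by rewrite char_sum_row // oppr_eq0 (negbTE nz) scale0r.
Qed.

Lemma char_proj_conj (Y : 'M[K]_a) (g : 'M[F]_k) c : g \in unitmx ->
  (forall v, Y *m X v = X (g *m v) *m Y) ->
  Y *m char_proj c = char_proj (c *m invmx g) *m Y.
Proof.
move=> ug h; have gI : injective (mulmx g : 'cV_k -> 'cV_k) by apply: can_inj (mulKmx ug).
rewrite /char_proj mulmx_sumr mulmx_suml [in RHS](reindex_inj gI).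
apply: eq_bigr => v _; rewrite -scalemxAr h -scalemxAl; congr (psi (- _) *: _).
by rewrite dot_mulmx mulKmx.
Qed.

Lemma char_proj_fix : char_proj 0 = 1%:M -> forall v, X v = 1%:M.
Proof. by move=> e v; rewrite -[X v]mulmx1 -e char_proj_actl dot0l psi0 scale1r. Qed.

Lemma char_proj_rank : (\sum_c \rank (char_proj c) <= a)%N.
Proof. exact: orthogonal_idem_rank char_proj_orth. Qed.

End Projectors.

(** * Representations of SL *)

Section SLhom.

Variables (F : finFieldType) (k : nat).
Local Notation M := 'M[F]_(1 + k).

(** The [tau v] are the transvections along the fixed form [e0row], a copy of the additive group of
    columns; [lam g] normalizes this group and acts on it by [v |-> g *m v]. *)
Definition tau (v : 'cV[F]_k) : M := block_mx 1%:M 0 v 1%:M.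
Definition lam (g : 'M[F]_k) : M := block_mx 1%:M 0 0 g.

Lemma tau0 : tau 0 = 1%:M. Proof. by rewrite /tau -scalar_mx_block. Qed.

Lemma tauD v w : tau (v + w) = tau v *m tau w.
Proof. by rewrite /tau mulmx_block !mulmx1 !mul1mx !mulmx0 !mul0mx !addr0 !add0r. Qed.

Lemma lam_tau g v : lam g *m tau v = tau (g *m v) *m lam g.
Proof.
by rewrite /lam /tau !mulmx_block !mulmx1 !mul1mx !mulmx0 !mul0mx !addr0 !add0r.
Qed.

Lemma det_tau v : \det (tau v) = 1.
Proof. by rewrite det_lblock !det1 mulr1. Qed.

Lemma det_lam g : \det (lam g) = \det g.
Proof. by rewrite det_lblock det1 mul1r. Qed.

Definition e0row : 'rV[F]_(1 + k) := row_mx 1%:M 0.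

Lemma e0row_neq0 : e0row != 0.
Proof. by rewrite row_mx_eq0 negb_and -mxrank_eq0 mxrank1. Qed.

Lemma tau_transvection v : tau v = transvection (col_mx 0 v) e0row.
Proof.
by rewrite /transvection mul_col_row !mulmx0 mul0mx mulmx1 scalar_mx_block
  add_block_mx !addr0 add0r.
Qed.

Lemma det1_unit n (A : 'M[F]_n) : \det A = 1 -> A \in unitmx.
Proof. by rewrite unitmxE => ->; rewrite unitr1. Qed.

Lemma det1V n (A : 'M[F]_n) : \det A = 1 -> \det (invmx A) = 1.
Proof. by move=> dA; rewrite det_inv dA invr1. Qed.

Lemma transvection_conj n (A : 'M[F]_n) u phi : A \in unitmx ->
  A *m transvection u phi *m invmx A = transvection (A *m u) (phi *m invmx A).
Proof.
move=> uA; rewrite /transvection mulmxDr mulmxDl mulmx1 mulmxV //.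
by rewrite !mulmxA.
Qed.

(** By transitivity on nonzero rows, one matrix [A], depending on [phi] alone, conjugates all
    transvections along [phi] to some [tau v]. The first coordinate of [invmx A *m u] is
    [phi *m u = 0], so [dsubmx] loses nothing. *)
Lemma transvection_coords phi : (0 < k)%N -> phi != 0 -> exists2 A : M, \det A = 1 &
  phi = e0row *m invmx A /\ forall u, phi *m u = 0 ->
    transvection u phi = A *m tau (dsubmx (invmx A *m u)) *m invmx A.
Proof.
move=> k0 nz; have [|A dA pA] := @SL_trans_row F (1 + k) phi (e0row) _ nz e0row_neq0 => //.
have uA := det1_unit dA; exists A => //; split; first by rewrite -pA mulmxK.
move=> u pu; rewrite tau_transvection transvection_conj // -pA mulmxK //; congr transvection.
rewrite -[LHS](mulKVmx uA) -[in LHS](vsubmxK (invmx A *m u)); congr (_ *m col_mx _ _).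
suff -> : usubmx (invmx A *m u) = e0row *m (invmx A *m u).
  by rewrite -pA -mulmxA mulKVmx.
by rewrite -[in RHS](vsubmxK (invmx A *m u)) mul_row_col mul1mx mul0mx addr0.
Qed.

Lemma SL_tau_ind (P : M -> Prop) : (0 < k)%N -> P 1%:M ->
  (forall A B, \det A = 1 -> \det B = 1 -> P A -> P B -> P (A *m B)) ->
  (forall A v, \det A = 1 -> P (A *m tau v *m invmx A)) ->
  forall A, \det A = 1 -> P A.
Proof.
move=> k0 P1 PM Pt; apply: SL_ind => // u phi pu.
have [-> | nz] := eqVneq phi 0; first by rewrite transvection0r.
by have [A dA [_ ->]] := transvection_coords k0 nz; first exact: Pt.
Qed.

Section Representation.

Variables (K : fieldType) (a : nat) (X : M -> 'M[K]_a) (psi : F -> K).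

(** A representation of [SL], encoded as a function on all square matrices that is multiplicative at
    determinant 1. *)
Definition SL_repr := X 1%:M = 1%:M /\
  forall A B, \det A = 1 -> \det B = 1 -> X (A *m B) = X A *m X B.

Hypotheses (XP : SL_repr) (psiP : additive_char psi).
Hypotheses (card1 : (#|F| ^ k)%:R = 1 :> K) (k1 : (1 < k)%N).

Let X1 : X 1%:M = 1%:M. Proof. by case: XP. Qed.
Let XM A B : \det A = 1 -> \det B = 1 -> X (A *m B) = X A *m X B.
Proof. by case: XP => _; apply. Qed.

Lemma SL_reprV A : \det A = 1 -> X A *m X (invmx A) = 1%:M.
Proof. by move=> dA; rewrite -XM ?det1V // mulmxV ?det1_unit. Qed.

Lemma SL_repr_unit A : \det A = 1 -> X A \in unitmx.
Proof. by move=> dA; have /mulmx1_unit[] := SL_reprV dA. Qed.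

Lemma SL_repr_tau0 : X (tau 0) = 1%:M. Proof. by rewrite tau0 X1. Qed.

Lemma SL_repr_tauD v w : X (tau (v + w)) = X (tau v) *m X (tau w).
Proof. by rewrite tauD XM ?det_tau. Qed.

Definition tau_proj := char_proj psi (X \o tau).

Lemma tau_proj_conj g c : \det g = 1 ->
  X (lam g) *m tau_proj c = tau_proj (c *m invmx g) *m X (lam g).
Proof.
move=> dg; apply: char_proj_conj => [|v /=]; first exact: det1_unit.
by rewrite -!XM ?det_lam ?det_tau // lam_tau.
Qed.

(** For [k > 1] the group [SL_k] is transitive on nonzero rows, that is, on the nontrivial
    characters. *)
Lemma tau_proj_conj_nz c d : c != 0 -> d != 0 ->
  exists2 g, \det g = 1 & tau_proj d = X (lam g) *m tau_proj c *m invmx (X (lam g)).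
Proof.
move=> c0 d0; have [g dg e] := SL_trans_row k1 d0 c0.
exists g => //; rewrite tau_proj_conj // mulmxK ?SL_repr_unit ?det_lam //.
by rewrite -e mulmxK ?det1_unit.
Qed.

Lemma tau_proj_rank c d : c != 0 -> d != 0 -> \rank (tau_proj c) = \rank (tau_proj d).
Proof.
move=> c0 d0; have [g dg ->] := tau_proj_conj_nz c0 d0.
have u : X (lam g) \in unitmx by rewrite SL_repr_unit ?det_lam.
by rewrite mxrankMfree ?row_free_unit ?unitmx_inv // eqmxMfull ?row_full_unit.
Qed.

Lemma tau_proj_rank_sum c : c != 0 -> (\rank (tau_proj c) * (#|F| ^ k).-1 <= a)%N.
Proof.
move=> c0.
have := @char_proj_rank _ _ _ _ _ (X \o tau) psiP card1 SL_repr_tauD; apply: leq_trans.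
rewrite (bigD1 0) //=; apply: leq_trans (leq_addl _ _).
rewrite (eq_bigr (fun _ => \rank (tau_proj c))) => [|d d0]; last exact: tau_proj_rank.
rewrite sum_nat_const mulnC; suff -> : #|(fun d : 'rV[F]_k => d != 0)| = (#|F| ^ k).-1 by [].
by rewrite -[X in (_ ^ X)%N]mul1n -(card_mx F 1 k) -(cardC1 (0 : 'rV[F]_k)).
Qed.

(** All projectors of nontrivial characters have the same rank, so they all vanish; then every
    [tau v] acts trivially, and the conjugates of the [tau v] generate [SL]. *)
Lemma SL_repr_trivial c : c != 0 -> tau_proj c = 0 -> forall A, \det A = 1 -> X A = 1%:M.
Proof.
move=> c0 e.
have e0 : tau_proj 0 = 1%:M.
  rewrite -(@char_proj_sum _ _ _ _ _ (X \o tau) psiP card1 SL_repr_tau0) (bigD1 0) //= [X in _ + X]big1 ?addr0 //.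
  move=> d d0; apply/eqP; rewrite -mxrank_eq0.
  by have := tau_proj_rank d0 c0; rewrite e mxrank0 => ->.
have tr v : X (tau v) = 1%:M := @char_proj_fix _ _ _ _ _ (X \o tau) psiP SL_repr_tauD e0 v.
apply: SL_tau_ind => [||A B dA dB|A v dA] //; first exact: ltnW.
- by rewrite XM // => -> ->; rewrite mulmx1.
- have dAt : \det (A *m tau v) = 1 by rewrite det_mulmx dA det_tau mulr1.
  by rewrite !XM ?det_tau ?det1V // tr mulmx1 SL_reprV.
Qed.

Lemma SL_repr_degree : (a < (#|F| ^ k).-1)%N -> forall A, \det A = 1 -> X A = 1%:M.
Proof.
move=> small; have [c c0] : exists c : 'rV[F]_k, c != 0.
  by case: (k) k1 => // k' _; exists (const_mx 1); apply/rowV0Pn; exists (const_mx 1);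
    rewrite ?submx_refl //; apply/eqP => /rowP/(_ 0)/eqP; rewrite !mxE oner_eq0.
apply: (SL_repr_trivial c0); apply/eqP; rewrite -mxrank_eq0 -leqn0 leqNgt.
apply: contraL small => r; rewrite -leqNgt; apply: leq_trans (tau_proj_rank_sum c0).
by rewrite leq_pmull.
Qed.

End Representation.

End SLhom.

(** * Small actions of SL *)

(** Arithmetic for [tau_dichotomy]: [x] is the number of points, [y] the number of those with a
    nonzero dual, [t] the common size of the nonzero duals. The conclusions amount to [t = q] and to
    every point having a nonzero dual. *)
Lemma orbit_count_bound q x y t r : (2 < q)%N -> (0 < r)%N -> (x <= q * r)%N ->
  (t <= q)%N -> (q.-1 * r * t = y * t.-1)%N -> (y <= q * r)%N -> (0 < t)%N ->
  (q <= t)%N /\ (x <= y)%N.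
Proof.
move=> h1 h2 h3 h4 h5 h6 h7.
have qt : (q <= t)%N.
  have : (q.-1 * r * t <= q * r * t.-1)%N by rewrite h5 leq_mul2r h6 orbT.
  by rewrite -!mulnA ![(r * _)%N]mulnC !mulnA leq_pmul2r //; nia.
split=> //; have e : t = q by apply/eqP; rewrite eqn_leq h4.
move: h5; rewrite e; have -> : (q.-1 * r * q = q * r * q.-1)%N by nia.
by move=> /eqP; rewrite eqn_pmul2r => [/eqP <- //|]; lia.
Qed.

Section Dichotomy.

Variables (F : finFieldType) (k : nat) (X : finType).
Local Notation M := 'M[F]_(1 + k).
Variable act : M -> X -> X.

(** A right action, as for products of permutations, with its law required at determinant 1. *)
Definition SL_action := (forall x, act 1%:M x = x) /\
  forall A B x, \det A = 1 -> \det B = 1 -> act (A *m B) x = act B (act A x).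

Hypotheses (actP : SL_action) (k1 : (1 < k)%N).
Variable r : nat.
Hypotheses (q2 : (2 < #|F|)%N) (Qr : (#|F| ^ k = #|F|.-1 * r + 1)%N) (cardX : (#|X| <= #|F| * r)%N).

Let q_gt0 : (0 < #|F|)%N. Proof. exact: ltn_trans q2. Qed.

Variable psi : F -> algC.
Hypothesis psiP : additive_char psi.

Let act1 x : act 1%:M x = x. Proof. by case: actP. Qed.
Let actM A B x : \det A = 1 -> \det B = 1 -> act (A *m B) x = act B (act A x).
Proof. by case: actP => _; apply. Qed.

Lemma SL_actK A : \det A = 1 -> cancel (act A) (act (invmx A)).
Proof. by move=> dA x; rewrite -actM ?det1V // mulmxV ?det1_unit. Qed.

Lemma SL_act_inj A : \det A = 1 -> injective (act A).
Proof. by move=> dA; apply: can_inj (SL_actK dA). Qed.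

Let tact v x := act (tau v) x.
Let tact0 x : tact 0 x = x. Proof. by rewrite /tact tau0 act1. Qed.
Let tactD v w x : tact (v + w) x = tact w (tact v x).
Proof. by rewrite /tact tauD actM ?det_tau. Qed.

(** [tdual x] is the annihilator of the stabilizer [tstab x]: the characters that occur, each once,
    in the permutation module of the group of the [tau v] on the orbit [torb x]. *)
Definition tstab x := [set v : 'cV[F]_k | act (tau v) x == x].
Definition tdual x := [set c : 'rV[F]_k | [forall v in tstab x, psi (dot c v) == 1]].
Definition torb x := [set act (tau v) x | v : 'cV[F]_k].

Lemma tstabB x : {in tstab x &, forall v w, v - w \in tstab x}.
Proof.
move=> v w; rewrite !inE => /eqP hv /eqP hw.
have hw' : tact (- w) x = x by rewrite -{1}hw -tactD subrr tact0.
by rewrite -/(tact _ _) tactD [tact v x]hv hw'.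
Qed.

Lemma tstab0 x : 0 \in tstab x. Proof. by rewrite inE -/(tact _ _) tact0. Qed.

(** The sum of [psi (dot c v)] over all [c] and over [v] in [D] is computed in both orders. The
    values of [psi] are complex, so an equality in [algC] gives one between naturals. *)
Lemma char_perp_card (D : {set 'cV[F]_k}) : 0 \in D ->
  {in D &, forall v w, v - w \in D} ->
  (#|[set c | [forall v in D, psi (dot c v) == 1%R]]| * #|D| = #|F| ^ k)%N.
Proof.
move=> D0 DB; set P := [set c | _].
apply/eqP; rewrite -(eqr_nat algC); apply/eqP.
have <- : \sum_c \sum_(v in D) psi (dot c v) = (#|F| ^ k)%:R.
  rewrite exchange_big (bigD1 0) //= [X in _ + X]big1 => [|v /andP[_ nz]].
    by rewrite addr0 char_sum_row // eqxx.
  by rewrite char_sum_row // (negbTE nz).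
rewrite (bigID (mem P)) /= [X in _ + X]big1 => [|c]; last first.
  by rewrite inE char_sum_set // => /negbTE ->.
rewrite addr0 (eq_bigr (fun _ => #|D|%:R)) => [|c].
  by rewrite sumr_const natrM mulr_natl.
by rewrite inE char_sum_set // => ->.
Qed.

Lemma tdual_stab x : (#|tdual x| * #|tstab x| = #|F| ^ k)%N.
Proof. by apply: char_perp_card; [apply: tstab0 | apply: tstabB]. Qed.

Lemma torbP x y : reflect (exists v, y = act (tau v) x) (y \in torb x).
Proof. by apply: (iffP imsetP) => [[v _ ->]|[v ->]]; exists v. Qed.

Lemma tstab_orb x y : y \in torb x -> tstab y = tstab x.
Proof.
case/torbP => v ->; apply/setP => w; rewrite !inE.
rewrite -!/(tact _ _) -tactD addrC tactD; apply/eqP/eqP => [|-> //].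
by apply: SL_act_inj; rewrite det_tau.
Qed.

Lemma tdual_orb x y : y \in torb x -> tdual y = tdual x.
Proof. by move=> h; rewrite /tdual (tstab_orb h). Qed.

Lemma torb_card x : #|torb x| = #|tdual x|.
Proof.
have Qpos : (0 < #|F| ^ k)%N by rewrite expn_gt0 q_gt0.
have st0 : (0 < #|tstab x|)%N by rewrite card_gt0; apply/set0Pn; exists 0; apply: tstab0.
apply/eqP; rewrite -(eqn_pmul2r st0) tdual_stab; apply/eqP.
have -> : (#|F| ^ k = \sum_(v : 'cV[F]_k) 1)%N by rewrite sum1_card card_mx muln1.
rewrite (partition_big (fun v => tact v x) (mem (torb x))) /= => [|v _]; last first.
  by apply/torbP; exists v.
rewrite (eq_bigr (fun _ => #|tstab x|)) ?sum_nat_const // => y /torbP[w ->].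
rewrite sum1_card -(card_imset (mem (tstab x)) (addrI w)); apply: eq_card => v.
apply/idP/imsetP => [/eqP e|[u + ->]].
  exists (v - w); last by rewrite addrCA subrr addr0.
  rewrite inE -/(tact _ _); apply/eqP; apply: (SL_act_inj (det_tau w)).
  by rewrite -!/(tact _ _) -tactD subrK.
by rewrite inE addrC => /eqP e; apply/eqP; rewrite tactD [tact u x]e.
Qed.

Lemma tdual0 x : 0 \in tdual x.
Proof.
by rewrite inE; apply/forall_inP => v _; rewrite dot0l; case: psiP => ->.
Qed.

Lemma tdualD x : {in tdual x &, forall c d, c + d \in tdual x}.
Proof.
move=> c d; rewrite !inE => /forall_inP hc /forall_inP hd; apply/forall_inP => v Ev.
by rewrite dotDl; case: psiP => _ -> _; rewrite (eqP (hc v Ev)) (eqP (hd v Ev)) mulr1.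
Qed.

Lemma tdualN x c : c \in tdual x -> - c \in tdual x.
Proof.
rewrite !inE => /forall_inP hc; apply/forall_inP => v Ev; rewrite dotNl -dotNr.
by apply: hc; rewrite -sub0r tstabB ?tstab0.
Qed.

Lemma tdual_lam g x c : \det g = 1 ->
  (c \in tdual (act (lam g) x)) = (c *m invmx g \in tdual x).
Proof.
move=> dg; have ug := det1_unit dg; have dl : \det (lam g) = 1 by rewrite det_lam.
have st v : (v \in tstab (act (lam g) x)) = (g *m v \in tstab x).
  by rewrite !inE -!actM ?det_tau // lam_tau actM ?det_tau // (inj_eq (SL_act_inj dl)).
rewrite !inE; apply/forall_inP/forall_inP => h v.
  move=> Ev; rewrite dot_mulmx; apply: h; by rewrite st mulKVmx.
by rewrite st => Ev; have := h _ Ev; rewrite dot_mulmx mulKmx.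
Qed.

Lemma tdual_lam_card g x : \det g = 1 -> #|tdual (act (lam g) x)| = #|tdual x|.
Proof.
move=> dg; have ug := det1_unit dg.
rewrite -(card_imset (mem (tdual x)) (can_inj (mulmxK ug))); apply: eq_card => c.
rewrite tdual_lam //; apply/idP/imsetP => [h|[d h ->]]; last by rewrite mulmxK.
by exists (c *m invmx g); rewrite ?mulmxKV.
Qed.

(** The multiplicity of the character [c] in the permutation character on [X]: an orbit whose dual
    contains [c] contributes as many terms as the inverse of each, hence 1. *)
Let weight c : rat := \sum_(x | c \in tdual x) (#|tdual x|%:R)^-1.

Let tdual_card_gt0 x : (0 < #|tdual x|)%N.
Proof. by rewrite card_gt0; apply/set0Pn; exists 0; apply: tdual0. Qed.

Let weight_conj c d : c != 0 -> d != 0 -> weight c = weight d.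
Proof.
move=> c0 d0; have [g dg <-] := SL_trans_row k1 d0 c0.
have dl : \det (lam g) = 1 by rewrite det_lam.
rewrite /weight (reindex_inj (SL_act_inj dl)); apply: eq_big => x.
  by rewrite tdual_lam // mulmxK ?det1_unit.
by rewrite tdual_lam_card.
Qed.

Let weight_orb x : \sum_(y in torb x) ((#|tdual y|%:R)^-1 : rat) = 1.
Proof.
rewrite (eq_bigr (fun _ => (#|tdual x|%:R)^-1)) => [|y /tdual_orb -> //].
by rewrite sumr_const torb_card -[_ *+ _]mulr_natr mulVf // pnatr_eq0 -lt0n.
Qed.

Let r_gt0 : (0 < r)%N.
Proof.
rewrite lt0n; apply/eqP => r0; move: Qr; rewrite r0 muln0 add0n => e.
have : (#|F| ^ 1 <= #|F| ^ k)%N by rewrite leq_pexp2l // ltnW.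
by rewrite e expn1 leqNgt (ltn_trans _ q2).
Qed.

(** The [#|F|.-1 * r] nontrivial characters have equal multiplicities, of total at most
    [#|X| <= #|F| * r], which is less than [2 * #|F|.-1 * r]. *)
Let weight_lt2 c : c != 0 -> weight c < 2%:R.
Proof.
move=> c0; have : \sum_(d : 'rV_k | d != 0) weight d <= #|X|%:R.
  rewrite /weight (exchange_big_dep xpredT) //= -sum1_card natr_sum ler_sum // => x _.
  rewrite sumr_const -[_ *+ _]mulr_natl -[X in _ <= X](divff (x := #|tdual x|%:R)); last first.
    by rewrite pnatr_eq0 -lt0n.
  rewrite ler_pM2r ?invr_gt0 ?ltr0n // ler_nat subset_leq_card //.
  by apply/subsetP => d /andP[].
rewrite (eq_bigr (fun _ => weight c)) => [|d d0]; last exact: weight_conj.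
rewrite sumr_const.
have -> : #|[pred d : 'rV[F]_k | d != 0]| = (#|F|.-1 * r)%N.
  apply/eqP; rewrite -(eqn_add2r 1) -Qr addn1.
  have := cardC1 (0 : 'rV[F]_k); rewrite card_mx mul1n => h.
  apply/eqP; rewrite -[RHS]prednK; last by rewrite expn_gt0 q_gt0.
  by rewrite -h.
move=> h; rewrite ltNge; apply/negP => w2.
have : (2 * (#|F|.-1 * r) <= #|F| * r)%N.
  rewrite -(ler_nat rat); apply: le_trans (_ : #|X|%:R <= _); last by rewrite ler_nat.
  apply: le_trans h; rewrite natrM mulr_natr; apply: ler_wMn2r w2.
by rewrite mulnA leq_pmul2r //; move: q2; clear; lia.
Qed.

(** Two different orbits with [c] in their duals would give [c] a multiplicity of at least 2. *)
Lemma tdual_uniq c x y : c != 0 -> c \in tdual x -> c \in tdual y -> y \in torb x.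
Proof.
move=> c0 cx cy; apply: contraLR (weight_lt2 c0) => nyx; rewrite -leNgt.
have dis z : z \in torb x -> z \notin torb y.
  case/torbP => v ->; apply: contra nyx => /torbP [w e]; apply/torbP.
  exists (v - w); rewrite -/(tact _ _) tactD -[tact v x]/(act (tau v) x) e.
  by rewrite -[act _ y]/(tact w y) -tactD subrr tact0.
have -> : 2%:R = \sum_(z in torb x) ((#|tdual z|%:R)^-1 : rat) + \sum_(z in torb y) (#|tdual z|%:R)^-1.
  by rewrite !weight_orb.
rewrite /weight.
rewrite [X in _ <= X](bigID (mem (torb x))) /= lerD //.
  rewrite [X in _ <= X](eq_bigl (mem (torb x))) // => z /=.
  by apply: andb_idl => /tdual_orb ->.
rewrite [X in _ <= X](bigID (mem (torb y))) /= -[X in X <= _]addr0 lerD //; last first.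
  by apply: sumr_ge0 => z _; rewrite invr_ge0 ler0n.
rewrite [X in _ <= X](eq_bigl (mem (torb y))) // => z /=.
apply: andb_idl => zy; rewrite (tdual_orb zy) cy /=.
by apply: contraL zy => /dis.
Qed.

(** If [g] fixes [c], the dual of [act (lam g) x] also contains [c]; by uniqueness of the orbit it
    is the dual of [x]. *)
Lemma tdual_fixed x c d g : c != 0 -> c \in tdual x -> \det g = 1 -> c *m g = c ->
  d \in tdual x -> d *m g \in tdual x.
Proof.
move=> c0 cx dg cg dx; have ug := det1_unit dg.
have cy : c \in tdual (act (lam g) x) by rewrite tdual_lam // -{1}cg mulmxK.
by rewrite -(tdual_orb (tdual_uniq c0 cx cy)) tdual_lam // mulmxK.
Qed.

Lemma tdual_scale_of x c w : c \in tdual x -> c != 0 -> w \in tdual x ->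
  ~~ (w <= c)%MS -> forall t, t *: c \in tdual x.
Proof.
move=> cx c0 wx wc t; have [u cu wu] := separating_col wc.
have tu : (t *: c) *m u = 0 by rewrite -scalemxAl cu scaler0.
(* This transvection fixes [c] and sends [w] to [w + t *: c]. *)
have := @tdual_fixed x c w (transvection u (t *: c)) c0 cx (det_transvection tu).
rewrite /transvection !mulmxDr !mulmx1 !mulmxA cu mul0mx addr0 wu mul1mx.
move=> /(_ erefl wx) h; rewrite -[_ *: _](addKr w); apply: tdualD => //.
exact: tdualN.
Qed.

(** Two independent elements bring in the plane they span, by scaling; any [y] outside the plane is
    the image of [w] under a transvection fixing [c]. *)
Lemma tdual_full x c w : c \in tdual x -> c != 0 -> w \in tdual x ->
  ~~ (w <= c)%MS -> forall y, y \in tdual x.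
Proof.
move=> cx c0 wx wc y.
have w0 : w != 0 by apply: contraNneq wc => ->; rewrite sub0mx.
have cw : ~~ (c <= w)%MS.
  apply: contra wc => /sub_rVP [t e]; apply/sub_rVP; exists t^-1.
  rewrite e scalerA mulVf ?scale1r //; apply: contra_neq c0 => t0.
  by rewrite e t0 scale0r.
have Fc := tdual_scale_of cx c0 wx wc; have Fw := tdual_scale_of wx w0 cx cw.
have [|] := boolP (y <= col_mx c w)%MS.
  case/submxP => t ->; rewrite -[t](@hsubmxK _ 1 1 1) mul_row_col.
  by rewrite [lsubmx t]mx11_scalar [rsubmx t]mx11_scalar !mul_scalar_mx tdualD.
move/separating_col => [u0]; rewrite mul_col_mx -[0 in X in X -> _]vsubmxK => /eq_col_mx [].
rewrite !linear0 => cu0 wu0 yu0; have [u1 cu1 wu1] := separating_col wc.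
(* Adding a multiple of [u0], which kills [c] and [w] but not [y], keeps the values of [u1] at [c]
   and [w] and gives [y] the same value 1 as [w]; hence [y - w] vanishes at [u]. *)
pose u := u1 + ((1 - (y *m u1) 0 0) *: u0).
have cu : c *m u = 0 by rewrite mulmxDr -scalemxAr cu1 cu0 scaler0 addr0.
have wu : w *m u = 1%:M by rewrite mulmxDr -scalemxAr wu1 wu0 scaler0 addr0.
have yu : y *m u = 1%:M.
  rewrite mulmxDr -scalemxAr yu0 {1}[y *m u1]mx11_scalar -scalemx1.
  by rewrite scalerBl scale1r addrC subrK.
have ywu : (y - w) *m u = 0 by rewrite mulmxBl yu wu subrr.
have := @tdual_fixed x c w (transvection u (y - w)) c0 cx (det_transvection ywu).
rewrite /transvection (mulmxDr c) (mulmxDr w) !mulmx1 !mulmxA cu wu mul0mx mul1mx addr0 addrC subrK.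
by move/(_ erefl wx).
Qed.

Lemma tdual_conj x z c d : c != 0 -> c \in tdual x -> d != 0 -> d \in tdual z ->
  exists2 g, \det g = 1 & d = c *m g /\ forall y, (y \in tdual z) = (y *m invmx g \in tdual x).
Proof.
move=> c0 cx d0 dz; have [g dg e] := SL_trans_row k1 c0 d0; exists g => //; split=> // y.
have dy : d \in tdual (act (lam g) x) by rewrite tdual_lam // -e mulmxK ?det1_unit.
by rewrite (tdual_orb (tdual_uniq d0 dy dz)) tdual_lam.
Qed.

(** The dual is the whole line of [c], and the product formula for cardinals then identifies the
    stabilizer with the kernel of [c]. *)
Lemma tstab_dual_small x c : c != 0 -> c \in tdual x -> (forall d, d \in tdual x -> (d <= c)%MS) ->
  (#|F| <= #|tdual x|)%N -> forall v, (v \in tstab x) = (dot c v == 0).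
Proof.
move=> c0 cx small qs.
have sm : tdual x \subset [set t *: c | t : F].
  by apply/subsetP => d /small /sub_rVP [t ->]; apply/imsetP; exists t.
have e : tdual x = [set t *: c | t : F].
  apply/eqP; rewrite eqEcard sm /=; apply: leq_trans qs.
  exact: leq_imset_card.
have Fc t : t *: c \in tdual x by rewrite e; apply/imsetP; exists t.
have st v : v \in tstab x -> dot c v = 0.
  move=> Ev; apply/eqP; apply: contraT => nz; have [_ _ [y ny]] := psiP.
  have := Fc (y / dot c v); rewrite inE => /forall_inP /(_ v Ev).
  by rewrite dotZl divfK // (negbTE ny).
pose D := [set v : 'cV[F]_k | dot c v == 0].
have D0 : 0 \in D by rewrite inE dot0r.
have DB : {in D &, forall v w, v - w \in D}.
  by move=> v w; rewrite !inE dotDr dotNr => /eqP -> /eqP ->; rewrite subrr.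
have sD : tstab x \subset D by apply/subsetP => v /st h; rewrite inE h.
suff -> : tstab x = D by move=> v; rewrite inE.
apply/eqP; rewrite eqEcard sD /=.
rewrite -(@leq_pmul2l #|tdual x|) // tdual_stab -(char_perp_card D0 DB).
rewrite leq_pmul2r; last by rewrite card_gt0; apply/set0Pn; exists 0.
apply: subset_leq_card; apply/subsetP => d; rewrite e => /imsetP[t _ ->].
rewrite inE; apply/forall_inP => v; rewrite inE dotZl => /eqP ->; rewrite mulr0.
by case: psiP => ->.
Qed.

Lemma tdual_trivial x : (forall c, c \in tdual x -> c = 0) -> forall v, act (tau v) x = x.
Proof.
move=> h v; have e : tdual x = [set 0].
  by apply/setP => c; rewrite in_set1; apply/idP/eqP => [/h //|->]; apply: tdual0.
have := tdual_stab x; rewrite e cards1 mul1n => hc.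
have /setP/(_ v) : tstab x = setT.
  by apply/eqP; rewrite eqEcard subsetT /= cardsT card_mx muln1 hc.
by rewrite !inE => /eqP.
Qed.

Lemma tdual_all x : (forall c, c \in tdual x) -> forall v, act (tau v) x = x -> v = 0.
Proof.
move=> h v Ev; have := tdual_stab x.
have -> : tdual x = setT by apply/setP => c; rewrite in_setT h.
rewrite cardsT card_mx mul1n => /eqP; rewrite -{2}[(#|F| ^ k)%N]muln1 eqn_pmul2l; last first.
  by rewrite expn_gt0 q_gt0.
move/cards1P => [w e]; have := tstab0 x; rewrite e inE => /eqP w0.
have : v \in tstab x by rewrite inE Ev.
by rewrite e inE -w0 => /eqP.
Qed.

(** If some nonzero dual lies in a line, transitivity on characters puts every nonzero dual in a
    line, and counting makes each dual a full line. Otherwise every nonzero dual is everything, and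
    uniqueness of the orbit puts all moved points in one orbit. *)
Lemma tau_dichotomy :
  (forall x, exists2 c : 'rV_k, c != 0 & forall v, (act (tau v) x == x) = (dot c v == 0)) \/
  (forall x, (forall v, act (tau v) x = x) \/ (forall v, act (tau v) x = x -> v = 0)) /\
  (forall x y v w, act (tau v) x != x -> act (tau w) y != y -> exists u, y = act (tau u) x).
Proof.
have nontriv x v : act (tau v) x != x -> exists2 c, c != 0 & c \in tdual x.
  move=> nv; have [c /andP[c0 cx]|h] := pickP (fun c => (c != 0) && (c \in tdual x)).
    by exists c.
  case/eqP: nv; apply: tdual_trivial => c cx.
  by apply/eqP; have := h c; rewrite cx andbT => /negbFE.
have [x /existsP[c /and3P[c0 cx /forall_inP small]]|none] := pickP (fun x =>
  [exists c, [&& c != 0, c \in tdual x & [forall d in tdual x, (d <= c)%MS]]]).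
  left; pose s := #|tdual x|.
  have sq : (s <= #|F|)%N.
    rewrite -cardsT; apply: leq_trans (leq_imset_card (fun t => t *: c) _).
    apply: subset_leq_card; apply/subsetP => d /small /sub_rVP [t ->].
    by apply/imsetP; exists t.
  have all_s z d : d != 0 -> d \in tdual z -> #|tdual z| = s /\ forall y, y \in tdual z -> (y <= d)%MS.
    move=> d0 dz; have [g dg [e h]] := tdual_conj c0 cx d0 dz; have ug := det1_unit dg.
    split; last by move=> y; rewrite h => /small; rewrite e -[X in _ -> (X <= _)%MS](mulmxKV ug) => /submxMr.
    rewrite /s -(card_imset (mem (tdual x)) (can_inj (mulmxK ug))); apply: eq_card => y.
    rewrite h; apply/idP/imsetP => [yx|[w wx ->]]; last by rewrite mulmxK.
    by exists (y *m invmx g); rewrite ?mulmxKV.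
  pose Y := [set z | [exists d, (d != 0) && (d \in tdual z)]].
  (* Pairs of a nonzero character and a point whose dual contains it: one orbit of [s] points per
     character, [s.-1] characters per point of [Y]. *)
  have cnt : (#|F|.-1 * r * s = #|Y| * s.-1)%N.
    transitivity (\sum_(d : 'rV[F]_k | d != 0%R) s)%N.
      rewrite sum_nat_const; congr (_ * _)%N; have := cardC1 (0 : 'rV[F]_k).
      by rewrite card_mx mul1n Qr addn1 /= => <-; apply: eq_card.
    transitivity (\sum_(d : 'rV[F]_k | d != 0%R) \sum_(z | d \in tdual z) 1)%N.
      apply: eq_bigr => d d0; have [g dg e] := SL_trans_row k1 c0 d0.
      have dz : d \in tdual (act (lam g) x) by rewrite tdual_lam // -e mulmxK ?det1_unit.
      have [<- _] := all_s _ _ d0 dz; rewrite sum1_card -torb_card; apply: eq_card => z.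
      apply/idP/idP => [/tdual_orb e1|h]; last exact: tdual_uniq h.
      by rewrite -topredE /= e1.
    rewrite (exchange_big_dep xpredT) //= (bigID (mem Y)) /= [X in (_ + X)%N]big1 ?addn0.
      rewrite -sum_nat_const; apply: eq_bigr => z; rewrite inE => /existsP[d /andP[d0 dz]].
      have [<- _] := all_s _ _ d0 dz; rewrite sum1_card [in RHS](cardD1 0) tdual0 /=.
      by apply: eq_card => y; rewrite !inE.
    move=> z; rewrite inE => /existsPn nz; rewrite big_pred0 // => d.
    by apply/negbTE/nz.
  have Yq : (#|Y| <= #|F| * r)%N by apply: leq_trans cardX; apply: max_card.
  have s0 : (0 < s)%N := tdual_card_gt0 x.
  have [sq1 YX] : (#|F| <= s)%N /\ (#|X| <= #|Y|)%N.
    exact: orbit_count_bound cardX sq cnt Yq s0.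
  have YT z : z \in Y.
    have /eqP -> : Y == setT by rewrite eqEcard subsetT cardsT.
    by rewrite inE.
  move=> z; have := YT z; rewrite inE => /existsP[d /andP[d0 dz]]; exists d => // v.
  have [e sm] := all_s _ _ d0 dz.
  by have := tstab_dual_small d0 dz sm; rewrite e => /(_ sq1 v); rewrite inE.
right; split.
  move=> x; have [c /andP[c0 cx]|h] := pickP (fun c => (c != 0) && (c \in tdual x)); last first.
    left; apply: tdual_trivial => c cx.
    by apply/eqP; have := h c; rewrite cx andbT => /negbFE.
  right; have := none x => /negbT; rewrite negb_exists => /forallP /(_ c).
  rewrite c0 cx /= => /forall_inPn [w wx wc]; apply: tdual_all.
  exact: tdual_full cx c0 wx wc.
move=> x y v w /nontriv [c c0 cx] /nontriv [d d0 dy].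
have := none x => /negbT; rewrite negb_exists => /forallP /(_ c).
rewrite c0 cx /= => /forall_inPn [e ex ec].
have dx := tdual_full cx c0 ex ec d.
by have /torbP := tdual_uniq d0 dx dy.
Qed.

End Dichotomy.

(** * Relations between transvections, and triviality of small actions *)

Lemma mx11_eq0 (R : nzRingType) (A : 'M[R]_1) : (A == 0) = (A 0 0 == 0).
Proof.
by apply/eqP/eqP => [->|e]; [rewrite mxE | rewrite [A]mx11_scalar e raddf0].
Qed.

Lemma exists_common_ker (F : fieldType) k (phi c : 'rV[F]_(1 + k)) : (1 < k)%N ->
  exists w : 'cV_(1 + k), [/\ w != 0, phi *m w = 0 & c *m w = 0].
Proof.
move=> k1; have : ~~ (1%:M <= col_mx phi c)%MS.
    apply/negP => /mxrankS; rewrite mxrank1 => h.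
    have := leq_trans h (rank_leq_row _); rewrite leqNgt => /negP; apply.
    by rewrite addn1 add1n !ltnS.
  case/row_subPn => i /separating_col [w]; rewrite mul_col_mx -[0 in X in X -> _]vsubmxK !linear0.
  move=> /eq_col_mx [pw cw] e; exists w; split=> //; apply: contraTneq isT => w0.
  by move: e; rewrite w0 mulmx0 => /matrixP/(_ 0 0)/eqP; rewrite !mxE eq_sym oner_eq0.
Qed.

Section MinimalDegree.

Variables (F : finFieldType) (k : nat) (X : finType).
Local Notation M := 'M[F]_(1 + k).
Local Notation tv := (@transvection F (1 + k)).

Section Actions.

Variable act : M -> X -> X.
Hypothesis actP : SL_action act.

Let act1 x : act 1%:M x = x. Proof. by case: actP. Qed.
Let actM A B x : \det A = 1 -> \det B = 1 -> act (A *m B) x = act B (act A x).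
Proof. by case: actP => _; apply. Qed.

Lemma SL_act_fix_conj A B x : \det A = 1 -> \det B = 1 ->
  (act (A *m B *m invmx A) x == x) = (act B (act A x) == act A x).
Proof.
move=> dA dB; rewrite !actM ?det1V ?det_mulmx ?dA ?dB ?mulr1 //.
rewrite -[X in _ == X](SL_actK actP dA x).
by rewrite (inj_eq (SL_act_inj actP (det1V dA))).
Qed.

Lemma SL_fixM A B x : \det A = 1 -> \det B = 1 -> act A x = x -> act B x = x ->
  act (A *m B) x = x.
Proof. by move=> dA dB eA eB; rewrite actM // eA. Qed.

(** The first case of the dichotomy for all forms [phi] at once; [c] counts modulo [phi], and
    [~~ (c <= phi)] says that it is not zero on the kernel of [phi]. *)
Definition hyperplane_stabilizers := forall x phi, phi != 0 ->
  exists2 c : 'rV_(1 + k), ~~ (c <= phi)%MS &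
    forall u, phi *m u = 0 -> (act (tv u phi) x == x) = (c *m u == 0).

Definition semiregular_stabilizers := forall x phi, phi != 0 ->
  (forall u, phi *m u = 0 -> act (tv u phi) x = x) \/
  (forall u, phi *m u = 0 -> act (tv u phi) x = x -> u = 0).

Lemma hyperplane_stabilizersI : (0 < k)%N ->
  (forall x, exists2 c : 'rV_k, c != 0 & forall v, (act (tau v) x == x) = (dot c v == 0)) ->
  hyperplane_stabilizers.
Proof.
move=> k0 h x phi nz; have [A dA [ephi tvA]] := transvection_coords k0 nz.
have uA := det1_unit dA; have [c c0 hc] := h (act A x).
exists (row_mx 0 c *m invmx A).
  rewrite ephi submxMfree ?row_free_unit ?unitmx_inv //.
  apply: contra c0 => /sub_rVP [t]; rewrite scale_row_mx scaler0 => /eq_row_mx [_ ->].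
  exact: eqxx.
move=> u pu; rewrite tvA // SL_act_fix_conj ?det_tau // hc /dot.
rewrite -mulmxA -[in RHS](vsubmxK (invmx A *m u)) mul_row_col mul0mx add0r.
by rewrite -mx11_eq0.
Qed.

Lemma semiregular_stabilizersI : (0 < k)%N ->
  (forall x, (forall v, act (tau v) x = x) \/ (forall v, act (tau v) x = x -> v = 0)) ->
  semiregular_stabilizers.
Proof.
move=> k0 h x phi nz; have [A dA [ephi tvA]] := transvection_coords k0 nz.
have uA := det1_unit dA; have [hA|hA] := h (act A x); [left|right] => u pu.
  by rewrite tvA //; apply/eqP; rewrite SL_act_fix_conj ?det_tau // hA.
rewrite tvA // => /eqP; rewrite SL_act_fix_conj ?det_tau // => /eqP /hA du.
rewrite -[u](mulKVmx uA) -[invmx A *m u]vsubmxK du.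
suff -> : usubmx (invmx A *m u) = e0row F k *m (invmx A *m u).
  by rewrite mulmxA -ephi pu col_mx0 mulmx0.
by rewrite -[in RHS](vsubmxK (invmx A *m u)) mul_row_col mul1mx mul0mx addr0.
Qed.

(** Whether a nontrivial transvection fixes [x] turns out to depend on its centre alone. The fixing
    centres in the kernel of [phi] have codimension one there; together with a fixing centre outside
    that kernel they span the kernel of a form [phi'], all of whose transvections then fix [x]. *)
Lemma hyperplane_stabilizers_absurd (x : X) : (1 < k)%N -> hyperplane_stabilizers -> False.
Proof.
move=> k1 hyp; pose T u phi := act (tv u phi) x = x.
have TD u w phi : phi *m u = 0 -> phi *m w = 0 -> T u phi -> T w phi -> T (u + w) phi.
  by move=> pu pw; rewrite /T -transvectionD //; apply: SL_fixM; apply: det_transvection.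
have TDr u phi psi : phi *m u = 0 -> psi *m u = 0 -> T u phi -> T u psi -> T u (phi + psi).
  by move=> pu pw; rewrite /T -transvectionDr //; apply: SL_fixM; apply: det_transvection.
have TN u phi : phi *m u = 0 -> T u phi -> T (- u) phi.
  move=> pu Tu; rewrite /T -{1}Tu -actM ?det_transvection ?transvection_unit //.
  by rewrite mulmxN pu oppr0.
(* Conjugation by [tv u phi] replaces [phi'] by [phi' - phi'(u) phi]; division by [tv w phi'] leaves
   a transvection along a multiple of [phi]. *)
have swap u w phi phi' : phi *m u = 0 -> phi *m w = 0 -> phi' *m w = 0 ->
    T u phi -> T w phi' -> T w (- ((phi' *m u) 0 0 *: phi)).
  move=> pu pw p'w Tu Tw.
  have e : tv u phi *m tv w phi' *m tv (- u) phi = tv w (phi' - (phi' *m u) 0 0 *: phi).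
    have ew : tv u phi *m w = w by rewrite mulmxDl mul1mx -mulmxA pw mulmx0 addr0.
    have ep : phi' *m tv (- u) phi = phi' - (phi' *m u) 0 0 *: phi.
      rewrite mulmxDr mulmx1 mulmxA mulmxN mulNmx.
      by rewrite {1}[phi' *m u]mx11_scalar mul_scalar_mx.
    rewrite [X in _ *m X *m _]/transvection mulmxDr mulmx1 mulmxDl transvection_unit //.
    by rewrite mulmxA ew -mulmxA ep.
  have T1 : T w (phi' - (phi' *m u) 0 0 *: phi).
    rewrite /T -e actM ?det_mulmx ?det_transvection ?mulr1 //; last by rewrite mulmxN pu oppr0.
    by rewrite actM ?det_transvection // Tu Tw; apply: TN.
  have T2 : T w (- phi').
    by have := TN _ _ p'w Tw; rewrite /T -scaleN1r transvectionZ scaleN1r.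
  rewrite -[- _]add0r -(subrr phi') addrAC; apply: TDr => //.
    by rewrite mulmxBl -scalemxAl pw scaler0 p'w subr0.
  by rewrite mulNmx p'w oppr0.
(* If [tv w phi] moves [x], no nontrivial transvection with centre [w] fixes [x]: by [swap], [phi']
   vanishes where [phi] and [c] do, then on the kernel of [phi], so it is a multiple of [phi]. *)
have A phi (c : 'rV_(1 + k)) w phi' : phi != 0 -> (forall u, phi *m u = 0 -> (act (tv u phi) x == x) = (c *m u == 0)) ->
   phi *m w = 0 -> c *m w != 0 -> phi' *m w = 0 -> T w phi' -> phi' = 0.
  move=> nz hc pw cw p'w Tw.
  have v1 (u : 'cV_(1 + k)) : phi *m u = 0 -> c *m u = 0 -> phi' *m u = 0.
    move=> pu cu; have Tu : T u phi by apply/eqP; rewrite hc // cu.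
    have := swap _ _ _ _ pu pw p'w Tu Tw; rewrite /T -scaleNr -transvectionZ => /eqP.
    rewrite hc -?scalemxAr ?pw ?scaler0 // scaler_eq0 (negbTE cw) orbF oppr_eq0 => /eqP e.
    by rewrite [phi' *m u]mx11_scalar e raddf0.
  have cs : c *m w = ((c *m w) 0 0)%:M := mx11_scalar _.
  have cw0 : (c *m w) 0 0 != 0.
    by apply: contra_neq cw => e; rewrite cs e raddf0.
  have v2 (v : 'cV_(1 + k)) : phi *m v = 0 -> phi' *m v = 0.
    move=> pv; have := v1 (v - ((c *m v) 0 0 / (c *m w) 0 0) *: w).
    rewrite !mulmxBr -!scalemxAr pv pw p'w !scaler0 !subr0; apply=> //.
    by rewrite {2}cs scale_scalar_mx divfK // -mx11_scalar subrr.
  have /sub_rVP [t e] : (phi' <= phi)%MS.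
    apply: contraT => /separating_col [v pv p'v]; move: (v2 v pv).
    by rewrite p'v => /matrixP/(_ 0 0)/eqP; rewrite !mxE oner_eq0.
  move: Tw; rewrite e /T -transvectionZ => /eqP; rewrite hc -?scalemxAr ?pw ?scaler0 //.
  by rewrite scaler_eq0 (negbTE cw) orbF => /eqP ->; rewrite scale0r.
have B w phi0 phi : phi0 != 0 -> phi0 *m w = 0 -> T w phi0 -> phi *m w = 0 -> T w phi.
  move=> nz0 p0w T0 pw; have [->|nz] := eqVneq phi 0; first by rewrite /T transvection0r.
  have [c _ hc] := hyp x phi nz; apply/eqP; rewrite hc //; apply: contraTT isT => cw.
  by case/eqP: nz0; apply: A hc pw cw p0w T0.
have [c0 _ hc0] := hyp x _ (e0row_neq0 F k).
have [w [w0 ew c0w]] := exists_common_ker (e0row F k) c0 k1.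
have Tw phi : phi *m w = 0 -> T w phi.
  by apply: (B w _ phi (e0row_neq0 F k) ew); apply/eqP; rewrite hc0 // c0w.
have [phi pw] := dual_col w0.
have nz : phi != 0.
  apply: contraTneq isT => p0; move: pw.
  by rewrite p0 mul0mx => /matrixP/(_ 0 0)/eqP; rewrite !mxE eq_sym oner_eq0.
have [c cphi hc] := hyp x phi nz.
(* The form that vanishes at [w] and at the fixing centres in the kernel of [phi]. *)
pose phi' := (c *m w) 0 0 *: phi - c.
have nz' : phi' != 0.
  by apply: contra cphi; rewrite subr_eq0 => /eqP <-; apply: scalemx_sub.
have p'w : phi' *m w = 0.
  rewrite mulmxBl -scalemxAl pw [c *m w]mx11_scalar scale_scalar_mx mulr1.
  by rewrite [(_%:M) 0 0]mxE eqxx mulr1n subrr.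
have [c' cphi' hc'] := hyp x phi' nz'.
case/negP: cphi'; apply: contraT => /separating_col [u p'u c'u].
suff /eqP : T u phi' by rewrite hc' // c'u => /eqP/matrixP/(_ 0 0)/eqP; rewrite !mxE oner_eq0.
pose a := (phi *m u) 0 0; pose u0 := u - a *: w.
have ea : phi *m u = a%:M := mx11_scalar _.
have pu0 : phi *m u0 = 0 by rewrite mulmxBr -scalemxAr pw ea scale_scalar_mx mulr1 subrr.
have p'u0 : phi' *m u0 = 0 by rewrite mulmxBr -scalemxAr p'w p'u scaler0 subr0.
have cu0 : c *m u0 = 0.
  have : phi' *m u0 = - (c *m u0) by rewrite mulmxBl -scalemxAl pu0 scaler0 sub0r.
  by rewrite p'u0 => /eqP; rewrite eq_sym oppr_eq0 => /eqP.
have -> : u = u0 + a *: w by rewrite subrK.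
apply: TD => //; first by rewrite -scalemxAr p'w scaler0.
  by apply: (B u0 phi) => //; apply/eqP; rewrite hc // cu0.
by rewrite /T transvectionZ; apply: Tw; rewrite -scalemxAl p'w scaler0.
Qed.

(** This is [tau a *m lam g]; shears multiply like affine maps. *)
Definition shear a g : M := block_mx 1%:M 0 a g.

Lemma shearM a g b h : shear a g *m shear b h = shear (a + g *m b) (g *m h).
Proof. by rewrite /shear mulmx_block !mul1mx !mul0mx !mulmx0 !mulmx1 !addr0 add0r. Qed.

Lemma det_shear a g : \det (shear a g) = \det g.
Proof. by rewrite det_lblock det1 mul1r. Qed.

Lemma shear_transvection (u : 'cV_k) phi s :
  shear (s *: u) (transvection u phi) = tv (col_mx 0 u) (row_mx s%:M phi).
Proof.
rewrite [RHS]/transvection mul_col_row !mul0mx scalar_mx_block add_block_mx !addr0.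
by rewrite add0r mul_mx_scalar.
Qed.

(* The shears fixing x are [shear (a g) g], where g |-> a g is a cocycle; on some transvection g
   the column a g is proportional to the centre of g, and the shear is then a transvection. *)
Lemma regular_unipotent_absurd (x : X) : (1 < k)%N -> 2%:R != 0 :> F ->
  (forall v, act (tau v) x = x -> v = 0) ->
  (forall A, \det A = 1 -> exists u, x = act (tau u) (act A x)) ->
  exists u phi, [/\ u != 0, phi != 0, phi *m u = 0 & act (tv u phi) x = x].
Proof.
move=> k1 two free trans.
(* [trans] gives every [g] a shear above it that fixes [x]; [free] makes this shear unique. *)
have ex g : \det g = 1 -> exists a, act (shear a g) x = x.
  move=> dg; have dl : \det (lam g) = 1 by rewrite det_lam.
  have [u e] := trans _ dl.
  exists (g *m u); rewrite {2}e -actM ?det_tau //; congr (act _ x).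
  by rewrite /lam /tau mulmx_block !mulmx1 !mul1mx !mulmx0 !mul0mx !addr0 !add0r.
have un a b g : \det g = 1 -> act (shear a g) x = x -> act (shear b g) x = x -> a = b.
  move=> dg ea eb; apply/eqP; rewrite -subr_eq0; apply/eqP/free.
  have e : shear a g = tau (a - b) *m shear b g.
    by rewrite -[tau _]/(shear _ 1%:M) shearM !mul1mx subrK.
  by move: ea; rewrite e actM ?det_tau ?det_shear // -{2}eb => /(SL_act_inj actP); apply;
    rewrite det_shear.
have comp a g b h : \det g = 1 -> \det h = 1 -> act (shear a g) x = x ->
    act (shear b h) x = x -> act (shear (a + g *m b) (g *m h)) x = x.
  by move=> dg dh ea eb; rewrite -shearM; apply: SL_fixM; rewrite ?det_shear.
suff [u [phi [s [u0 p0 pu es]]]] : exists (u : 'cV_k) phi s, [/\ u != 0, phi != 0, phi *m u = 0 &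
    act (shear (s *: u) (transvection u phi)) x = x].
  exists (col_mx 0 u), (row_mx s%:M phi); split; last by rewrite -shear_transvection.
  - by rewrite col_mx_eq0 negb_and u0 orbT.
  - by rewrite row_mx_eq0 negb_and p0 orbT.
  - by rewrite mul_row_col mulmx0 add0r.
have dd (i j : 'I_k) : i != j -> delta_mx 0 j *m delta_mx i 0 = 0 :> 'M[F]_1.
  by move=> ne; rewrite mul_delta_mx_0 // eq_sym.
have dd1 (i : 'I_k) : delta_mx 0 i *m delta_mx i 0 = 1%:M :> 'M[F]_1.
  by rewrite mul_delta_mx; apply/matrixP => a b; rewrite !ord1 !mxE.
pose t i j : 'M[F]_k := transvection (delta_mx i 0) (delta_mx 0 j).
have dt i j : i != j -> \det (t i j) = 1 by move=> ne; apply: det_transvection; apply: dd.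
have tE i j (v : 'cV_k) : t i j *m v = v + v j 0 *: delta_mx i 0.
  rewrite /t /transvection mulmxDl mul1mx -mulmxA -rowE; congr (_ + _).
  by rewrite [row j v]mx11_scalar mul_mx_scalar mxE.
have fin i j s : i != j -> act (shear (s *: delta_mx i 0) (t i j)) x = x ->
    exists (u : 'cV_k) phi s, [/\ u != 0, phi != 0, phi *m u = 0 &
    act (shear (s *: u) (transvection u phi)) x = x].
  move=> ne e; exists (delta_mx i 0), (delta_mx 0 j), s; split=> //; last exact: dd.
    by apply/eqP => /matrixP/(_ i 0)/eqP; rewrite !mxE !eqxx oner_eq0.
  by apply/eqP => /matrixP/(_ 0 j)/eqP; rewrite !mxE !eqxx oner_eq0.
have k0 : (0 < k)%N := ltnW k1.
pose i1 := Ordinal k0; pose i2 := Ordinal k1; have n12 : i1 != i2 by [].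
(* k = 2: compare the cocycle on the two sides of (-1) t = t (-1);
   k >= 3: use the relations [t12, t13] = 1 and t12 t23 = t13 t23 t12. *)
have [k2|k2] := ltnP 2 k; last first.
  have ke : k = 2 by apply/eqP; rewrite eqn_leq k2.
  have dz : \det (- 1%:M : 'M[F]_k) = 1.
    by rewrite -scaleN1r scalemx1 det_scalar [in LHS]ke sqrrN expr1n.
  have [az ez] := ex _ dz; have [at_ et] := ex _ (dt _ _ n12).
  have E1 := comp _ _ _ _ dz (dt _ _ n12) ez et.
  have := comp _ _ _ _ (dt _ _ n12) dz et ez.
  have -> : t i1 i2 *m - 1%:M = - 1%:M *m t i1 i2 by rewrite mulmxN mulmx1 mulNmx mul1mx.
  have dzt : \det (- 1%:M *m t i1 i2) = 1 by rewrite det_mulmx dz dt // mulr1.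
  move=> /(un _ _ _ dzt E1); rewrite mulNmx mul1mx tE => e.
  apply: (fin i1 i2 (- (2%:R^-1 * az i2 0)) n12).
  suff <- : at_ = - (2%:R^-1 * az i2 0) *: delta_mx i1 0 by [].
  apply: (scalerI two); rewrite scalerA mulrN mulrA mulfV // mul1r.
  have e2 : at_ + at_ = (az - at_) - (az + az i2 0 *: delta_mx i1 0) + at_ by rewrite e addrK.
  rewrite scaler_nat mulr2n {1}e2; apply/matrixP => a b; rewrite !mxE; ring.
pose i3 := Ordinal k2; have n13 : i1 != i3 by []; have n23 : i2 != i3 by [].
have [a12 e12] := ex _ (dt _ _ n12); have [a13 e13] := ex _ (dt _ _ n13).
have [a23 e23] := ex _ (dt _ _ n23).
have c1 : a12 + t i1 i2 *m a13 = a13 + t i1 i3 *m a12.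
  apply: (un _ _ (t i1 i2 *m t i1 i3)); first by rewrite det_mulmx !dt // mulr1.
    exact: comp (dt _ _ n12) (dt _ _ n13) e12 e13.
  have -> : t i1 i2 *m t i1 i3 = t i1 i3 *m t i1 i2.
    by rewrite /t !transvectionDr ?dd // addrC.
  exact: comp (dt _ _ n13) (dt _ _ n12) e13 e12.
have c2 : a12 + t i1 i2 *m a23 = a13 + t i1 i3 *m (a23 + t i2 i3 *m a12).
  have d1 : \det (t i2 i3 *m t i1 i2) = 1 by rewrite det_mulmx !dt // mulr1.
  apply: (un _ _ (t i1 i2 *m t i2 i3)); first by rewrite det_mulmx !dt // mulr1.
    exact: comp (dt _ _ n12) (dt _ _ n23) e12 e23.
  have -> : t i1 i2 *m t i2 i3 = t i1 i3 *m (t i2 i3 *m t i1 i2).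
    have h (i j : 'I_k) : i != j -> (j == i) = false by rewrite eq_sym => /negbTE.
    rewrite /t /transvection !mul_delta_mx.
    rewrite !(mulmxDl, mulmxDr, mul1mx, mulmx1, mul_delta_mx_cond, mulr0n, mulr1n, eqxx,
      h _ _ n12, h _ _ n13, h _ _ n23).
    by rewrite mulmx0 !addr0 addrA; congr (_ + _); apply: addrAC.
  exact: comp (dt _ _ n13) d1 e13 (comp _ _ _ _ (dt _ _ n23) (dt _ _ n12) e23 e12).
rewrite !tE in c1 c2.
have f1 : a13 i2 0 = a12 i3 0.
  move: c1; rewrite addrCA => /addrI/addrI /(congr1 (fun v : 'cV_k => v i1 0)).
  by rewrite !mxE !eqxx !mulr1.
have f2 : a23 i2 0 *: delta_mx i1 0 = a13 + a12 i3 0 *: delta_mx i2 0 +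
    (a23 + (a12 + a12 i3 0 *: delta_mx i2 0)) i3 0 *: delta_mx i1 0 :> 'cV_k.
  by apply: (addrI (a12 + a23)); rewrite -[LHS]addrA c2; apply/matrixP => a b; rewrite !mxE; ring.
have f3 : a12 i3 0 = 0.
  have := congr1 (fun v : 'cV_k => v i2 0) f2; rewrite !mxE f1 !eqxx.
  rewrite [i2 == i1]eq_sym (negbTE n12) !mulr0 addr0 mulr1 -mulr2n -mulr_natl => /esym/eqP.
  by rewrite mulf_eq0 (negbTE two) => /eqP.
move: f2; rewrite f3 scale0r addr0 => /eqP; rewrite -subr_eq -scalerBl => /eqP f2.
by move: e13; rewrite -f2; apply: fin.
Qed.

End Actions.

(** Inverse transpose exchanges centres and forms of transvections, so that facts about a fixed form
    become facts about a fixed centre. *)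
Lemma SL_action_contragredient (act : M -> X -> X) : SL_action act ->
  SL_action (fun A x => act (invmx A)^T x).
Proof.
case=> act1 actM; split=> [x|A B x dA dB]; first by rewrite invmx1 trmx1.
rewrite -actM ?det_tr ?det1V // -trmx_mul; congr (act _^T x).
by rewrite -[LHS]mulmx1; apply: (canLR (mulKmx _)); rewrite ?unitmx_mul ?det1_unit //
   !mulmxA mulmxK ?mulmxV ?det1_unit.
Qed.

Variable r : nat.
Hypotheses (k1 : (1 < k)%N) (q2 : (2 < #|F|)%N) (two : 2%:R != 0 :> F).
Hypotheses (Qr : (#|F| ^ k = #|F|.-1 * r + 1)%N) (cardX : (#|X| <= #|F| * r)%N).

(** The dichotomy is applied with a complex character, and its first case is refuted by
    [hyperplane_stabilizers_absurd]. *)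
Lemma SL_action_semiregular (act : M -> X -> X) : SL_action act ->
  semiregular_stabilizers act /\ forall x y v w, act (tau v) x != x -> act (tau w) y != y ->
    exists u, y = act (tau u) x.
Proof.
move=> actP; have [p _ pF] := finPcharP F.
have [z zP] := C_prim_root_exists (prime_gt0 (pcharf_prime pF)).
have zn1 : z != 1.
  apply: contraTneq (prime_gt1 (pcharf_prime pF)) => z1.
  by rewrite -leqNgt; apply: dvdn_leq => //; rewrite (prim_order_dvd zP) z1 expr1n.
have [psi psiP] := additive_char_exists pF (prim_expr_order zP) zn1.
case: (tau_dichotomy actP k1 q2 Qr cardX psiP) => [h | [h1 h2]].
  split=> [x phi nz | x]; case: (hyperplane_stabilizers_absurd actP x k1).
    exact: hyperplane_stabilizersI (ltnW k1) h.
  exact: hyperplane_stabilizersI (ltnW k1) h.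
by split=> //; apply: semiregular_stabilizersI => //; apply: ltnW.
Qed.

(** A point fixed by one nontrivial transvection is fixed by [SL], by alternating between a common
    form and a common centre. A point fixed by none has a regular orbit under the [tau v] that
    contains its whole [SL]-orbit, and [regular_unipotent_absurd] produces a fixing transvection all
    the same. *)
Theorem SL_action_trivial (act : M -> X -> X) : SL_action act -> forall A x, \det A = 1 -> act A x = x.
Proof.
move=> actP A x dA; have actP' := SL_action_contragredient actP.
have [semi orb] := SL_action_semiregular actP.
have [semi' _] := SL_action_semiregular actP'.
have semi_dual y w : w != 0 -> (forall chi, chi *m w = 0 -> act (tv w chi) y = y) \/
    (forall chi, chi *m w = 0 -> act (tv w chi) y = y -> chi = 0).
  move=> w0; have wT0 : w^T != 0 by rewrite -trmx0 (inj_eq trmx_inj).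
  have e chi : chi *m w = 0 -> (invmx (tv (- chi^T) w^T))^T = tv w chi /\ w^T *m (- chi^T) = 0.
    move=> cw; have h : w^T *m (- chi^T) = 0 by rewrite mulmxN -trmx_mul cw trmx0 oppr0.
    split=> //; have := transvection_unit h; rewrite opprK => h1.
    have -> : invmx (tv (- chi^T) w^T) = tv chi^T w^T.
      by rewrite -[RHS](mulKmx (det1_unit (det_transvection h))) h1 mulmx1.
    by rewrite /transvection linearD /= trmx1 trmx_mul !trmxK.
  have [h|h] := semi' y w^T wT0; [left|right] => chi cw; have [e1 e2] := e chi cw.
    by rewrite -e1; apply: h.
  rewrite -e1 => /(h _ e2) /eqP; rewrite oppr_eq0 => /eqP e3.
  by apply: trmx_inj; rewrite e3 trmx0.
have fixall y : (exists u phi, [/\ u != 0, phi != 0, phi *m u = 0 & act (tv u phi) y = y]) ->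
    forall B, \det B = 1 -> act B y = y.
  case=> u0 [phi0 [u0n p0n pu0 fix0]].
  have h0 : forall u, phi0 *m u = 0 -> act (tv u phi0) y = y.
    by have [//|h] := semi y phi0 p0n; case/eqP: u0n; apply: h.
  apply: SL_ind => [|B C dB dC eB eC|u phi pu]; first by case: actP.
    exact: SL_fixM.
  have [->|pn] := eqVneq phi 0; first by rewrite transvection0r; case: actP.
  (* From [phi0] to [phi] through transvections with the centre [w], which lies in both kernels. *)
  have [w [wn p0w pw]] := exists_common_ker phi0 phi k1.
  have h1 : act (tv w phi) y = y.
    by have [h|h] := semi_dual y w wn; [apply: h | case/eqP: p0n; apply: h p0w (h0 _ p0w)].
  by have [h|h] := semi y phi pn; [apply: h | case/eqP: wn; apply: h pw h1].
apply/eqP; apply: contraT => nfix; suff : False by [].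
have nofix : ~ (exists u phi, [/\ u != 0, phi != 0, phi *m u = 0 & act (tv u phi) x = x]).
  by move=> /fixall /(_ A dA) /eqP; rewrite (negbTE nfix).
have v0 : exists v : 'cV[F]_k, v != 0.
  exists (delta_mx (Ordinal (ltnW k1)) 0).
  by apply/eqP => /matrixP/(_ (Ordinal (ltnW k1)) 0)/eqP; rewrite !mxE !eqxx oner_eq0.
have tauE v y : v != 0 -> act (tau v) y = y ->
    exists u phi, [/\ u != 0, phi != 0, phi *m u = 0 & act (tv u phi) y = y].
  move=> vn e; exists (col_mx 0 v), (e0row F k); split; rewrite -?tau_transvection ?e0row_neq0 //.
    by rewrite col_mx_eq0 negb_and vn orbT.
  by rewrite mul_row_col mulmx0 mul0mx addr0.
apply: (nofix); apply: (regular_unipotent_absurd actP k1 two).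
  by move=> v e; apply/eqP; apply: contraT => vn; case: nofix; apply: tauE e.
move=> B dB; have [v vn] := v0; apply: (orb _ _ v v).
  apply/eqP => /(tauE _ _ vn) /fixall h; have := h _ (det1V dB).
  by rewrite SL_actK // => e; have := h A dA; rewrite -e => /eqP; rewrite (negbTE nfix).
by apply/eqP => /(tauE _ _ vn).
Qed.

End MinimalDegree.

(** * Algebras normalized by SL *)

Section SchurRing.

Variables (F : finFieldType) (gT : finGroupType) (G : {group gT}) (n : nat).
Variable rG : mx_representation F G n.+1.

(** The centralizer is packaged as a finite ring: by Schur's lemma it is a domain when the module is
    irreducible, and Wedderburn's little theorem makes it commutative. *)
Definition cent_pred : pred 'M[F]_n.+1 := [pred f | centgmx rG f].

Fact cent_divring_closed : divring_closed cent_pred.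
Proof.
split=> [|f g /centgmxP cf /centgmxP cg|f g /centgmxP cf /centgmxP cg].
- by apply/centgmxP => x _; rewrite mulmx1 mul1mx.
- by apply/centgmxP => x Gx; rewrite mulmxBl mulmxBr cf // cg.
apply/centgmxP => x Gx; have [ug|ng] := boolP (g \in unitmx); last first.
  by rewrite invr_out // -!mulmxE -mulmxA cg // mulmxA cf // mulmxA.
apply: (can_inj (mulmxK ug)).
by rewrite -!mulmxA -cg // !mulmxA !mulmxKV // cf.
Qed.

HB.instance Definition _ := GRing.isDivringClosed.Build _ cent_pred cent_divring_closed.

Record cent_ring := CentRing { cent_val :> 'M[F]_n.+1; _ : cent_pred cent_val }.
HB.instance Definition _ := [isSub for cent_val].
HB.instance Definition _ := [Finite of cent_ring by <:].
HB.instance Definition _ := [SubChoice_isSubUnitRing of cent_ring by <:].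

Lemma cent_ring_domain : mx_irreducible rG -> GRing.integral_domain_axiom cent_ring.
Proof.
move=> irr x y xy; apply/norP => -[x0 y0].
have [cx cy] : centgmx rG (val x) /\ centgmx rG (val y) by split; apply: (valP).
have := mx_Schur irr cx x0; have := mx_Schur irr cy y0.
move=> uy ux; have /(congr1 val) := xy; rewrite rmorphM rmorph0 /= => e.
have : val x *m val y \in unitmx by rewrite unitmx_mul ux.
by rewrite [_ *m _]e unitr0.
Qed.

Lemma mx_irr_cent_commS f g : mx_irreducible rG -> centgmx rG f -> centgmx rG g -> f *m g = g *m f.
Proof.
move=> irr cf cg.
have := @finDomain_mulrC cent_ring (cent_ring_domain irr) (CentRing cf) (CentRing cg).
by move/(congr1 val); rewrite !rmorphM.
Qed.

End SchurRing.

Lemma mx_irr_cent_comm (F : finFieldType) (gT : finGroupType) (G : {group gT}) n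
  (rG : mx_representation F G n) f g :
  mx_irreducible rG -> centgmx rG f -> centgmx rG g -> f *m g = g *m f.
Proof.
by case: n rG f g => [|n] rG f g; [rewrite !(flatmx0 (_ *m _)) | apply: mx_irr_cent_commS].
Qed.

Lemma F2_cases (x : 'F_2) : x = 0 \/ x = 1.
Proof. by case: x => [[|[|//]] h]; [left|right]; apply: val_inj. Qed.

Section SLgroupHom.

Variables (F : finFieldType) (k : nat).
Local Notation M := 'M[F]_(1 + k).

(** [SL] is perfect: as 2 is invertible in [F], [tau v] is conjugate to its square [tau (v + v)], so
    its image in an abelian group equals its own square. *)
Lemma SL_hom_abelian (gT : finGroupType) (A : {group gT}) (f : M -> gT) :
  (1 < k)%N -> 2%:R != 0 :> F -> abelian A ->
  (forall g, \det g = 1 -> f g \in A) ->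
  (forall g h, \det g = 1 -> \det h = 1 -> f (g *m h) = (f g * f h)%g) ->
  forall g, \det g = 1 -> f g = 1%g.
Proof.
move=> k1 two abA fA fM.
have f1 : f 1%:M = 1%g.
  by apply: (mulgI (f 1%:M)); rewrite -fM ?det1 // mulmx1 mulg1.
have fJ g h : \det g = 1 -> \det h = 1 -> f (g *m h *m invmx g) = f h.
  move=> dg dh; have ug := det1_unit dg.
  rewrite !fM ?det1V ?det_mulmx ?dg ?dh ?mulr1 //.
  have cgh : commute (f g) (f h) by apply: (centsP abA); apply: fA.
  by rewrite cgh -mulgA -fM ?det1V // mulmxV // f1 mulg1.
have ftau v : f (tau v) = 1%g.
  have [->|v0] := eqVneq v 0; first by rewrite tau0.
  have v2 : v + v != 0 by rewrite -mulr2n -scaler_nat scaler_eq0 negb_or two.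
  have [g dg e] := SL_trans_col k1 v0 v2; have ug := det1_unit dg.
  have dl : \det (lam g) = 1 by rewrite det_lam.
  have h : f (tau (v + v)) = f (tau v).
    by rewrite -e -(fJ (lam g) (tau v) dl (det_tau v)) lam_tau mulmxK ?det1_unit.
  by apply: (mulgI (f (tau v))); rewrite mulg1 -fM ?det_tau // -tauD h.
apply: SL_tau_ind => [|//|g h dg dh fg fh|g v dg]; first exact: ltnW.
  by rewrite fM // fg fh mulg1.
by rewrite fJ ?det_tau.
Qed.

End SLgroupHom.

(** * Isotypic modules of a finite group *)

Section Isotypic.

Variables (F : finFieldType) (gT : finGroupType) (H : {group gT}) (n : nat).
Variable (rH : mx_representation F H n) (M : 'M[F]_n).
Hypotheses (simM : mxsimple rH M) (isoM : (1%:M <= component_mx rH M)%MS).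
Local Notation E_H := (enveloping_algebra_mx rH).

(** The space is a sum of isomorphic copies of [M], and an element of the enveloping algebra that
    kills [M] kills each copy. *)
Lemma isotypic_annihilate A : (A \in E_H)%MS -> M *m A = 0 -> A = 0.
Proof.
move=> EA MA0; have [I [W isoW eW]] := component_mx_def simM.
apply/eqP; rewrite -submx0 -[A]mul1mx.
apply: submx_trans (submxMr A isoM) _; rewrite eW sumsmxMr.
apply/sumsmx_subP => i _; have [f uf homf defW] := isoW i.
by rewrite -(eqmxMr A defW) -(hom_envelop_mxC homf EA) MA0 mul0mx sub0mx.
Qed.

(** A nonzero kernel would be a submodule containing a copy of [M]; then [A] would kill [M], hence
    everything. *)
Lemma isotypic_central_unit A : (A \in E_H)%MS -> centgmx rH A -> A != 0 -> A \in unitmx.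
Proof.
move=> EA cA; apply: contraNT => nuA.
have nzK : kermx A != 0 by rewrite kermx_eq0 row_free_unit.
apply: (mxsimple_exists (kermx_centg_module cA) nzK) => -[W simW WK].
have [f uf homf defW] := component_mx_iso simM simW (submx_trans (submx1 _) isoM).
apply/eqP/isotypic_annihilate => //; apply: (can_inj (mulmxK uf)).
rewrite (hom_envelop_mxC homf EA) mul0mx; apply/eqP; rewrite -submx0 (eqmxMr A defW).
by rewrite submx0; apply/eqP/sub_kermxP.
Qed.

(** A copy of [M] other than [M] itself would meet [M] trivially and need twice the rank of [M]. *)
Lemma isotypic_half : (n < \rank M + \rank M)%N -> (1%:M <= M)%MS.
Proof.
move=> big; have [I [W isoW eW]] := component_mx_def simM.
apply: submx_trans isoM _; rewrite eW; apply/sumsmx_subP => i _.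
have simW := mx_iso_simple (isoW i) simM.
have [modM nzM minM] := simM; have [modW nzW minW] := simW.
have [cap0|nz] := eqVneq (M :&: W i)%MS 0; last first.
  by apply: submx_trans (minW _ _ (capmxSr _ _) nz) (capmxSl _ _); apply: capmx_module.
have := mxrank_sum_cap M (W i); rewrite cap0 mxrank0 addn0 -(mxrank_iso (isoW i)) => e.
by move: big; rewrite -e ltnNge rank_leq_col.
Qed.

Let rM := submod_repr (mxsimple_module simM).

(** The centralizer of [rM] is commutative, so by the density theorem [f] lies in the enveloping
    algebra of [rM] and lifts to some [A] in [E_H]. Since [E_H] acts faithfully on [M], [A] is
    central, hence scalar. *)
Lemma isotypic_cent_scalar :
  (forall A, (A \in E_H)%MS -> centgmx rH A -> is_scalar_mx A) ->
  forall f, centgmx rM f -> is_scalar_mx f.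
Proof.
move=> Zscal f cf; have irrM : mx_irreducible rM by apply/submod_mx_irr.
have : (f \in enveloping_algebra_mx rM)%MS.
  apply: submx_trans (mx_Jacobson_density irrM); apply/cent_mxP => g.
  rewrite memmx_cent_envelop => cg.
  exact: mx_irr_cent_comm irrM cg cf.
case/envelop_mxP => a ef; pose A := \sum_(x in H) a x *: rH x.
have EA : (A \in E_H)%MS by apply/envelop_mxP; exists a.
have valA m (W : 'M_(m, \rank M)) : val_submod (W *m f) = val_submod W *m A.
  rewrite ef /A !mulmx_sumr linear_sum; apply: eq_bigr => x Hx /=.
  by rewrite -!scalemxAr linearZ /= val_submodJ.
have cA : centgmx rH A.
  apply/centgmxP => x Hx; apply/eqP; rewrite -subr_eq0; apply/eqP.
  apply: isotypic_annihilate.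
    by rewrite linearB /= addmx_sub ?eqmx_opp ?envelop_mxM ?envelop_mx_id.
  have eM : (M <= val_submod (U := M) 1%:M)%MS by rewrite val_submod1.
  have h : val_submod (U := M) 1%:M *m A *m rH x = val_submod 1%:M *m rH x *m A.
    by rewrite -valA -!(val_submodJ (mxsimple_module simM)) // -valA !mul1mx (centgmxP cf).
  have /submxP [D ->] := eM.
  by rewrite -mulmxA mulmxBr (mulmxA _ A) (mulmxA _ (rH x)) h subrr mulmx0.
case/is_scalar_mxP: (Zscal _ EA cA) => c eA; apply/is_scalar_mxP; exists c.
apply: (@val_submod_inj _ _ M); rewrite -[f]mul1mx valA eA mul_mx_scalar.
by rewrite -[in RHS]scalemx1 linearZ.
Qed.

End Isotypic.

(** * Subalgebras normalized by an irreducible representation of SL *)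

Section VerySimple.

Variables (F K : finFieldType) (k : nat) (d' : nat).
Hypothesis K2 : forall x : K, x = 0 \/ x = 1.
Local Notation SM := 'M[F]_(1 + k).
Local Notation d := d'.+1.
Variable rho : SM -> 'M[K]_d.
Hypotheses (k1 : (1 < k)%N) (two : 2%:R != 0 :> F).
Hypothesis rhoP : SL_repr rho.
Hypothesis irr : forall U : 'M[K]_d,
  (forall A, \det A = 1 -> (U *m rho A <= U)%MS) -> U != 0 -> row_full U.
Hypothesis cent_rho : forall f,
  (forall A, \det A = 1 -> f *m rho A = rho A *m f) -> is_scalar_mx f.
Hypothesis small_action : forall (X : finType) (act : SM -> X -> X),
  SL_action act -> (#|X| <= d)%N -> forall A x, \det A = 1 -> act A x = x.
Hypothesis small_repr : forall a (X : SM -> 'M[K]_a), SL_repr X -> (a + a <= d)%N ->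
  forall A, \det A = 1 -> X A = 1%:M.

Let rho1 : rho 1%:M = 1%:M. Proof. by case: rhoP. Qed.
Let rhoM A B : \det A = 1 -> \det B = 1 -> rho (A *m B) = rho A *m rho B.
Proof. by case: rhoP => _; apply. Qed.
Let rho_unit A : \det A = 1 -> rho A \in unitmx := SL_repr_unit rhoP (A := A).

Let gT : finGroupType := {'GL_d[K]}.
Let GLv (x : gT) : 'M[K]_d := GLval x.
(** [rho A] as an element of [GL]; at determinant 1 it is invertible and the default value does not
    occur. *)
Let sigma A : gT := insubd (1%g : gT) (rho A).

Let sigmaE A : \det A = 1 -> GLv (sigma A) = rho A.
Proof. by move=> dA; rewrite /GLv /sigma val_insubd (rho_unit dA). Qed.

Let GLv_inj : injective GLv.
Proof. by move=> x y e; apply: val_inj. Qed.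
Let GLvM x y : GLv (x * y)%g = GLv x *m GLv y. Proof. by []. Qed.
Let sigmaM A B : \det A = 1 -> \det B = 1 -> sigma (A *m B) = (sigma A * sigma B)%g.
Proof.
move=> dA dB; have : GLv (sigma (A *m B)) = GLv (sigma A * sigma B)%g.
  by rewrite GLvM !sigmaE ?rhoM // det_mulmx dA dB mulr1.
exact: GLv_inj.
Qed.

Let GLvV x : GLv x^-1 = invmx (GLv x). Proof. by []. Qed.
Let GLv_unit x : GLv x \in unitmx. Proof. exact: (valP x). Qed.

Variable R : {set 'M[K]_d}.
Hypotheses (R1 : 1%:M \in R) (RD : {in R &, forall A B, A + B \in R})
  (RM : {in R &, forall A B, A *m B \in R})
  (RJ : forall A X, \det A = 1 -> X \in R -> rho A *m X *m invmx (rho A) \in R).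

Lemma R0 : 0 \in R.
Proof.
suff -> : 0 = 1%:M + 1%:M :> 'M[K]_d by apply: RD.
have e : 1 + 1 = 0 :> K.
  case: (K2 (1 + 1)) => // e1; have := oner_neq0 K.
  by rewrite -{1}(addrK 1 1) e1 subrr eqxx.
by rewrite -[LHS](raddf0 (@scalar_mx _ d)) -e raddfD.
Qed.

Lemma R_sum (I : finType) (P : pred I) (f : I -> 'M_d) :
  (forall i, P i -> f i \in R) -> \sum_(i | P i) f i \in R.
Proof. by move=> h; elim/big_ind: _ => //; apply: R0. Qed.

Lemma R_scale (a : K) A : A \in R -> a *: A \in R.
Proof.
by move=> RA; case: (K2 a) => ->; rewrite ?scale0r ?scale1r ?R0.
Qed.

(** The units of [R]. Inverses come for free, the ambient group being finite. *)
Definition Gam_set : {set gT} := [set x | GLv x \in R].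

Lemma Gam_group_set : group_set Gam_set.
Proof.
apply/group_setP; split; first by rewrite inE.
by move=> x y; rewrite !inE GLvM => Rx Ry; apply: RM.
Qed.
Canonical Gam := Group Gam_group_set.

Lemma memGam x : (x \in Gam) = (GLv x \in R). Proof. by rewrite inE. Qed.

Lemma sigma_norm A : \det A = 1 -> sigma A \in 'N(Gam).
Proof.
move=> dA; rewrite -groupV inE; apply/subsetP => _ /imsetP[x Gx ->].
move: Gx; rewrite !memGam conjgE invgK !GLvM GLvV sigmaE // mulmxA; exact: RJ.
Qed.

(** Clifford theory is applied to [Gam] inside its normalizer, which contains every [sigma A] and
    therefore acts irreducibly. *)
Let rN : mx_representation K 'N(Gam) d := subg_repr (GLrepr K d') (subsetT 'N(Gam)).
Let rNE x : rN x = GLv x. Proof. by []. Qed.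
Let nsGN : Gam <| 'N(Gam) := normalG Gam.
Let rG : mx_representation K Gam d := subg_repr rN (normal_sub nsGN).
Let rGE x : rG x = GLv x. Proof. by []. Qed.

Lemma irrN : mx_irreducible rN.
Proof.
apply/mx_irrP; split=> // U modU; apply: irr => A dA.
by rewrite -sigmaE // -rNE; apply: (mxmoduleP modU); apply: sigma_norm.
Qed.

Lemma envelop_R A : (A \in enveloping_algebra_mx rG)%MS -> A \in R.
Proof.
case/envelop_mxP => a ->; apply: R_sum => x Gx; apply: R_scale.
by rewrite rGE -memGam.
Qed.

(** [SL] permutes the homogeneous components of [Gam]; there are at most [d] of them, so each is
    stable, hence everything by irreducibility. [classically] comes from the existence of a
    socle. *)
Lemma isotypic : classically (exists2 M, mxsimple rG M & (1%:M <= component_mx rG M)%MS).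
Proof.
move=> b h; apply: (socle_exists rG) => sH.
have [W _ _] := imsetP (Clifford_atrans irrN sH).
apply: h; exists (socle_base W); first exact: socle_simple.
pose act A (W : sH) : sH := Clifford_action sH W (sigma A).
have actP : SL_action act.
  split=> [V|A B V dA dB]; rewrite /act.
    have -> : sigma 1%:M = 1%g by apply: (mulgI (sigma 1%:M)); rewrite -sigmaM ?det1 // mulmx1 mulg1.
    exact: act1.
  by rewrite sigmaM // actMin ?sigma_norm.
have cardS : (#|sH| <= d)%N.
  rewrite -[X in (_ <= X)%N](Clifford_rank_components irrN W) leq_pmulr // lt0n mxrank_eq0.
  exact: nz_socle.
rewrite sub1mx; apply: irr; last exact: nz_socle.
move=> A dA; have := small_action actP cardS W dA; rewrite /act => eW.
rewrite -[X in (X <= _)%MS]/(W *m _)%R -sigmaE // -rNE.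
by rewrite -(val_Clifford_act W (sigma_norm dA)) eW.
Qed.

Lemma scalar_cases (A : 'M[K]_d) : is_scalar_mx A -> A = 0 \/ A = 1%:M.
Proof.
case/is_scalar_mxP => a ->; case: (K2 a) => ->; [left|right] => //.
exact: raddf0.
Qed.

Lemma Gam_fixed_trivial x : (forall A, \det A = 1 -> (x ^ sigma A)%g = x) -> x = 1%g.
Proof.
move=> h; have /cent_rho /scalar_cases : forall A, \det A = 1 -> GLv x *m rho A = rho A *m GLv x.
  move=> A dA; rewrite -sigmaE // -!GLvM; congr GLv.
  by rewrite -{2}(h A dA) -conjgC.
case=> e; last exact: GLv_inj.
by have := GLv_unit x; rewrite e [_ \in _]unitr0.
Qed.

Section Component.

Variable M : 'M[K]_d.
Hypotheses (simM : mxsimple rG M) (isoM : (1%:M <= component_mx rG M)%MS).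

(** Differences of distinct central elements are invertible, so the centre is cyclic, like a finite
    group in a division ring. Its automorphism group is abelian, so the perfect group [SL]
    centralizes it and [Gam_fixed_trivial] applies. *)
Lemma center_Gam : 'Z(Gam)%g = 1%g.
Proof.
have cyc : cyclic 'Z(Gam).
  apply: (div_ring_mul_group_cyclic (f := GLv)) => //; last exact: center_abelian.
  move=> x /setD1P[x1 /setIP[Gx cGx]].
  apply: (isotypic_central_unit simM isoM).
  - by rewrite linearB /= addmx_sub ?eqmx_opp ?envelop_mx1 // -rGE envelop_mx_id.
  - apply/centgmxP => y Gy; rewrite rGE mulmxBl mulmxBr mulmx1 mul1mx; congr (_ - _).
    by rewrite -!GLvM (centP cGx).
  - by rewrite subr_eq0; apply: contra x1 => /eqP e; apply/eqP/GLv_inj.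
have abA : abelian (Aut 'Z(Gam)) := Aut_cyclic_abelian cyc.
have nZ A : \det A = 1 -> sigma A \in 'N('Z(Gam)).
  by move=> dA; apply: (subsetP (char_norms (center_char Gam))); apply: sigma_norm.
apply/eqP; rewrite -subG1; apply/subsetP => z Zz; rewrite inE; apply/eqP.
apply: Gam_fixed_trivial => A dA.
have e : conj_aut 'Z(Gam) (sigma A) = 1%g.
  apply: (@SL_hom_abelian F k _ (Aut_group 'Z(Gam)) (fun A => conj_aut 'Z(Gam) (sigma A)) k1 two abA)
    => // [B dB|B C dB dC].
    by rewrite (subsetP (Aut_conj_aut _ 'N('Z(Gam)))) // mem_morphim ?nZ.
  by rewrite sigmaM // morphM ?nZ.
by rewrite -(norm_conj_autE (nZ A dA) Zz) e perm1.
Qed.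

(** A nonzero central element of the enveloping algebra is a unit of [R], hence lies in the trivial
    centre of [Gam]. *)
Lemma central_scalar A : (A \in enveloping_algebra_mx rG)%MS -> centgmx rG A -> is_scalar_mx A.
Proof.
move=> EA cA; have [->|nz] := eqVneq A 0; first by apply/is_scalar_mxP; exists 0; rewrite raddf0.
have uA := isotypic_central_unit simM isoM EA cA nz.
pose x : gT := insubd (1%g : gT) A.
have xE : GLv x = A by rewrite /GLv /x val_insubd uA.
suff : x \in 'Z(Gam)%g.
  by rewrite center_Gam inE -xE => /eqP ->; apply: scalar_mx_is_scalar.
apply/setIP; split; first by rewrite memGam xE envelop_R.
by apply/centP => y Gy; apply: GLv_inj; rewrite !GLvM xE; apply: (centgmxP cA).
Qed.

Let a := \rank M.
Let rM := submod_repr (mxsimple_module simM).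
Let B : 'M[K]_(a, d) := val_submod 1%:M.

Let valE m (W : 'M_(m, a)) : val_submod W = W *m B. Proof. exact: val_submodE. Qed.

Let B_inj m : injective (fun W : 'M_(m, a) => W *m B).
Proof. by move=> W1 W2; rewrite -!valE => /val_submod_inj. Qed.

Let BJ x : x \in Gam -> rM x *m B = B *m GLv x.
Proof.
by move=> Gx; rewrite -valE -[rM x]mul1mx (val_submodJ (mxsimple_module simM)).
Qed.

Let cent_rM f : centgmx rM f -> is_scalar_mx f.
Proof. exact: isotypic_cent_scalar isoM central_scalar f. Qed.

Let a_gt0 : (0 < a)%N.
Proof. by rewrite lt0n mxrank_eq0; case: simM. Qed.

(** [U] implements on [M] the conjugation of [Gam] by [sigma A]. *)
Definition twisting (A : SM) (U : 'M[K]_a) := (U \in unitmx) &&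
  [forall x in Gam, rM x *m U == U *m rM (x ^ sigma A)%g].

Lemma twistingP A U : reflect (U \in unitmx /\ forall x, x \in Gam -> rM x *m U = U *m rM (x ^ sigma A)%g)
  (twisting A U).
Proof.
apply: (iffP andP) => -[uU h]; split=> //.
  by move=> x Gx; apply/eqP; move/forall_inP: h; apply.
by apply/forall_inP => x Gx; rewrite h.
Qed.

(** The translate of [M] by the inverse of [g] is simple, hence isomorphic to [M]; the isomorphism
    followed by [g] maps [M] to itself. *)
Lemma twisting_exists A : \det A = 1 -> exists U, twisting A U.
Proof.
move=> dA; pose g := sigma A; have Ng : g \in 'N(Gam) := sigma_norm dA.
have Ng' : g^-1%g \in 'N(Gam) by rewrite groupV.
have simM1 := Clifford_simple simM Ng'.
have [f uf homf defM1] := component_mx_iso simM simM1 (submx_trans (submx1 _) isoM).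
have BM : (B <= M)%MS by rewrite /B val_submod1.
have rB : \rank B = a by rewrite /B val_submod1.
have sB : (B *m f *m GLv g <= M)%MS.
  rewrite -[X in (_ <= X)%MS](mulmxKV (GLv_unit g)) submxMr //.
  by rewrite -[M *m _]/(M *m rN g^-1%g) -defM1 submxMr.
pose U := in_submod M (B *m f *m GLv g).
have UB : U *m B = B *m f *m GLv g by rewrite -valE in_submodK.
exists U; apply/twistingP; split.
  rewrite -row_free_unit /row_free eqn_leq rank_leq_row /=.
  apply: leq_trans (mxrankM_maxl U B); rewrite UB.
  by rewrite mxrankMfree ?row_free_unit ?GLv_unit // mxrankMfree ?row_free_unit // rB.
move=> x Gx; have NxA : (x ^ g)%g \in Gam by rewrite memJ_norm.
have e1 : B *m f *m GLv x = B *m GLv x *m f.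
  by rewrite -[GLv x]rGE (hom_mxP (submx_trans BM homf)).
have e2 : rM x *m U *m B = rM x *m B *m f *m GLv g by rewrite -!(mulmxA (rM x)) UB.
have e3 : U *m rM (x ^ g)%g *m B = U *m B *m GLv (x ^ g)%g.
  by rewrite -!(mulmxA U) BJ.
apply: B_inj; rewrite e2 e3 BJ // -e1 UB.
by rewrite -!(mulmxA (B *m f)) -!GLvM conjgC.
Qed.

(** Two choices differ by an invertible scalar of a field with two elements, that is, by 1. *)
Lemma twisting_uniq A U V : twisting A U -> twisting A V -> U = V.
Proof.
move=> /twistingP[uU hU] /twistingP[uV hV].
have /cent_rM /is_scalar_mxP [c e] : centgmx rM (U *m invmx V).
  apply/centgmxP => x Gx; rewrite [in RHS]mulmxA hU //.
  rewrite -(mulmxA U (invmx V)) -(mulmxA U (rM _)); congr (U *m _).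
  by apply: (can_inj (mulKmx uV)); rewrite mulKVmx // mulmxA -hV // mulmxK.
have eU : U = c%:M *m V by rewrite -e mulmxKV.
case: (K2 c) eU => ->; last by rewrite mul1mx.
rewrite raddf0 mul0mx => U0; move: uU; rewrite -row_free_unit /row_free U0 mxrank0.
by rewrite eq_sym -leqn0 leqNgt a_gt0.
Qed.

Lemma twist_exists : exists tw : SM -> 'M[K]_a, forall A, \det A = 1 -> twisting A (tw A).
Proof.
exists (fun A => odflt 1%:M [pick U | twisting A U]) => A dA; case: pickP => // h.
by have [U hU] := twisting_exists dA; have := h U; rewrite hU.
Qed.

Lemma sigma1 : sigma 1%:M = 1%g.
Proof. by apply: (mulgI (sigma 1%:M)); rewrite -sigmaM ?det1 // mulmx1 mulg1. Qed.

(** Uniqueness makes the a priori projective representation on [M] a linear one. *)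
Lemma twist_repr (tw : SM -> 'M[K]_a) :
  (forall A, \det A = 1 -> twisting A (tw A)) -> SL_repr tw.
Proof.
move=> twP; split=> [|A C dA dC].
  apply: (@twisting_uniq 1%:M); first exact/twP/det1.
  apply/twistingP; split; first exact: unitmx1.
  by move=> x _; rewrite mulmx1 mul1mx sigma1 conjg1.
have dAC : \det (A *m C) = 1 by rewrite det_mulmx dA dC mulr1.
apply: (@twisting_uniq (A *m C)); first exact: twP.
have /twistingP[uA hA] := twP A dA; have /twistingP[uC hC] := twP C dC.
apply/twistingP; split=> [|x Gx]; first by rewrite unitmx_mul; apply/andP.
have GxA : (x ^ sigma A)%g \in Gam by rewrite memJ_norm ?sigma_norm.
rewrite (mulmxA (rM x)) hA // -(mulmxA (tw A)) hC //.
by rewrite (mulmxA (tw A)) sigmaM // conjgM.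
Qed.

(** If [M] fills at most half of the space, the twisting representation is trivial; as [Gam] acts
    faithfully on [M], conjugation by [SL] fixes [Gam] pointwise. Otherwise [M] is the whole space,
    absolutely irreducible because its centralizer is scalar, and its enveloping algebra, contained
    in [R], is the full matrix algebra. *)
Lemma Gam_trivial_or_full : Gam = 1%G \/ forall A, A \in R.
Proof.
have [tw twP] := twist_exists; have [small|big] := leqP (a + a) d.
  left; apply/trivGP/subsetP => x Gx; rewrite inE; apply/eqP.
  apply: Gam_fixed_trivial => A dA; have GxA : (x ^ sigma A)%g \in Gam by rewrite memJ_norm ?sigma_norm.
  have /twistingP[_ /(_ x Gx)] := twP A dA; rewrite (small_repr (twist_repr twP) small dA) mulmx1 mul1mx => e.
  apply: GLv_inj; apply/eqP; rewrite -subr_eq0; apply/eqP.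
  apply: (isotypic_annihilate simM isoM).
    have envG y : y \in Gam -> (GLv y \in enveloping_algebra_mx rG)%MS.
      by move=> Gy; rewrite -rGE envelop_mx_id.
    by rewrite linearB addmx_sub ?eqmx_opp ?envG.
  have : (M <= B)%MS by rewrite /B val_submod1.
  case/submxP => D ->; rewrite -mulmxA mulmxBr -!/(GLv _) -!BJ // e.
  by rewrite subrr mulmx0.
right=> A; apply: envelop_R.
have M1 : (M :=: 1%:M)%MS by apply/eqmxP; rewrite submx1 (isotypic_half simM isoM big).
have irrM : mx_irreducible rM by apply/submod_mx_irr.
have absM : mx_absolutely_irreducible rM.
  apply: cent_mx_scalar_abs_irr => //; rewrite leqNgt.
  apply/(has_non_scalar_mxP (scalar_mx_cent _ _)) => -[f cf].
  by rewrite cent_rM // -memmx_cent_envelop.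
have : mx_absolutely_irreducible rG.
  by rewrite -(mx_rsim_abs_irr (rsim_submod1 (mxsimple_module simM) M1)).
by case/andP => _ full; apply: submx_full.
Qed.

End Component.

Lemma Gam_cases : Gam = 1%G \/ forall A, A \in R.
Proof.
have [h|h] := classic (Gam = 1%G \/ forall A, A \in R); first exact: h.
have : false; last by [].
by apply: isotypic => -[M simM isoM]; case: h; apply: Gam_trivial_or_full simM isoM.
Qed.

(** * Algebras whose only unit is 1 *)

Section TrivialUnits.

Hypothesis Gam1 : Gam = 1%G.

Lemma R_unit X : X \in R -> X \in unitmx -> X = 1%:M.
Proof.
move=> RX uX; pose x : gT := insubd (1%g : gT) X.
have xE : GLv x = X by rewrite /GLv /x val_insubd uX.
have : x \in Gam by rewrite memGam xE.
by rewrite Gam1 inE -xE => /eqP ->.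
Qed.

Lemma addmx_self (X : 'M[K]_d) : X + X = 0.
Proof.
rewrite -[X]scale1r -scalerDl; case: (K2 (1 + 1)) => e; first by rewrite e scale0r.
by have := oner_neq0 K; rewrite -{1}(addrK 1 1) e subrr eqxx.
Qed.

Lemma oppmx_self (X : 'M[K]_d) : - X = X.
Proof. by apply/eqP; rewrite eq_sym -subr_eq0 opprK addmx_self. Qed.

Lemma R_exp (X : 'M[K]_d) n : X \in R -> X ^+ n \in R.
Proof. by move=> RX; elim: n => [|n IH]; rewrite ?expr0 // exprS; apply: RM. Qed.

Lemma exists_idem_power (X : 'M[K]_d) : exists2 n, (0 < n)%N & X ^+ n * X ^+ n = X ^+ n.
Proof.
have [i [j [ij e]]] : exists i j, (i < j)%N /\ X ^+ i = X ^+ j.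
  pose f (i : 'I_#|{: 'M[K]_d}|.+1) := X ^+ i.
  have /injectivePn [i [j ne e]] : ~~ injectiveb f.
    by apply/negP => /injectiveP /leq_card; rewrite card_ord ltnn.
  by case: (ltngtP i j) ne => [ij _|ji _|/val_inj -> /eqP //]; [exists i, j | exists j, i].
have e1 n : X ^+ (i + n) = X ^+ (i + n + (j - i)).
  by rewrite addnAC subnKC ?(ltnW ij) // !exprD e.
have e2 n t : X ^+ (i + n) = X ^+ (i + n + t * (j - i)).
  elim: t => [|t IH]; first by rewrite addn0.
  by rewrite IH -[in LHS]addnA e1 -!addnA mulSn [(t * _ + _)%N]addnC.
have ij0 : (0 < j - i)%N by rewrite subn_gt0.
(* A multiple of the period [j - i] that is at least [i]. *)
exists (i.+1 * (j - i))%N; first by rewrite muln_gt0.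
have le : (i <= i.+1 * (j - i))%N by apply: leq_trans (leqnSn i) _; apply: leq_pmulr.
by rewrite -exprD -{1 3}(subnKC le) -e2.
Qed.

(** Fitting decomposition along an idempotent power [e] of [X]: the units [1 - e + X * e] and
    [1 - X * (1 - e)] must both be 1, so [X] is the identity on the part of [e] and zero on the
    complement. *)
Lemma R_idem (X : 'M[K]_d) : X \in R -> X * X = X.
Proof.
move=> RX; have [[//|n] _ ee] := exists_idem_power X.
set e := X ^+ n.+1 in ee; pose z := X ^+ n.
have Re : e \in R by apply: R_exp.
have Xz : X * z = e by rewrite -exprS.
have cXe : X * e = e * X by rewrite -exprS -exprSr.
have cze : z * e = e * z by rewrite -!exprD addnC.
have RB Y Z : Y \in R -> Z \in R -> Y - Z \in R by move=> RY RZ; rewrite oppmx_self RD.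
have e0 : (1 - e) * e = 0 by rewrite mulrBl mul1r ee subrr.
have e0' : e * (1 - e) = 0 by rewrite mulrBr mulr1 ee subrr.
have /R_unit h1 : 1 - e + X * e \in R by rewrite RD ?RB ?RM.
have Xe : X * e = e.
  have /h1 : 1 - e + X * e \in unitmx.
    (* On the part of [e], the inverse of [X] is [z], since [X * z = e]. *)
    have aux i : i * e = 0 -> e * i = 0 -> i * i = i -> i + e = 1 -> (i + X * e) * (i + z * e) = 1.
      move=> ie ei ii i1; rewrite mulrDl !mulrDr ii cze mulrA ie mul0r addr0.
      rewrite -[X * e * i]mulrA ei mulr0 add0r -mulrA (mulrA e e) ee -cze mulrA Xz ee.
      exact: i1.
    have /mulmx1_unit[] // : (1 - e + X * e) *m (1 - e + z * e) = 1.
    by apply: aux => //; rewrite ?subrK // mulrBr mulr1 e0 subr0.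
  move/(congr1 (fun Y => Y - (1 - e))); rewrite addrC addKr => ->.
  by rewrite -[1%:M]/(1 : 'M_d) opprB addrC subrK.
have cX1 : GRing.comm X (1 - e) by apply: commrB; [apply: commr1 | exact: cXe].
have nil : (X * (1 - e)) ^+ n.+1 = 0.
  by rewrite exprMn_comm // -/e [(1 - e) ^+ _]exprS (mulrA e) e0' mul0r.
have Xe' : X * (1 - e) = 0.
  have : 1 - X * (1 - e) = 1.
    apply: R_unit; first by rewrite RB ?RM ?RB.
    have := subrX1 (X * (1 - e)) n.+1; rewrite nil sub0r => h.
    suff /mulmx1_unit[] : (1 - X * (1 - e)) * (\sum_(i < n.+1) (X * (1 - e)) ^+ i) = 1 by [].
    by rewrite -opprB mulNr -h opprK.
  by move/eqP; rewrite subr_eq addrC -subr_eq subrr eq_sym => /eqP.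
have XE : X = e by rewrite -[LHS]mulr1 -[1](subrK e) mulrDr Xe' add0r.
by rewrite XE.
Qed.

Lemma R_comm (X Y : 'M[K]_d) : X \in R -> Y \in R -> X * Y = Y * X.
Proof.
move=> RX RY; have := R_idem (RD RX RY).
rewrite mulrDl !mulrDr !R_idem // -addrA => /addrI; rewrite addrA => h.
rewrite -[RHS]oppmx_self; apply/eqP; rewrite -subr_eq0 opprK; apply/eqP.
by apply: (addIr Y); rewrite add0r.
Qed.

(** The atoms of the Boolean ring [R]. *)
Definition atoms : {set 'M[K]_d} :=
  [set e in R | (e != 0) && [forall f in R, (e * f == 0) || (e * f == e)]].

Lemma atomsP e : e \in atoms -> [/\ e \in R, e != 0 & forall f, f \in R -> e * f = 0 \/ e * f = e].
Proof.
rewrite inE => /and3P[Re nz /forall_inP h]; split=> // f /h.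
by case/orP => /eqP; [left|right].
Qed.

Lemma card_atoms : (#|atoms| <= d)%N.
Proof.
(* The atoms, extended by zero to a family of orthogonal idempotents indexed by all matrices. *)
pose E (x : 'M[K]_d) : 'M[K]_d := if x \in atoms then x else 0.
have orth x y : E x *m E y = E x *+ (x == y).
  rewrite /E; case: ifP => ax; last by rewrite mul0mx mul0rn.
  case: ifP => ay; last by case: eqP ay => [<-|_ _]; rewrite ?ax // mulmx0.
  have [Rx nx hx] := atomsP ax; have [Ry ny hy] := atomsP ay.
  have [<-|ne] := eqVneq x y; first exact: R_idem.
  rewrite mulr0n -[_ *m _]/(x * y); case: (hx y Ry) => // e1.
  rewrite R_comm //; case: (hy x Rx) => // e2.
  by case/eqP: ne; rewrite -[LHS]e1 -[RHS]e2; apply: R_comm.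
apply: leq_trans (orthogonal_idem_rank orth).
rewrite (bigID (mem atoms)) /= -sum1_card; apply: leq_trans (leq_addr _ _).
apply: leq_sum => x ax; rewrite /E ax lt0n mxrank_eq0.
by have [] := atomsP ax.
Qed.

Lemma rhoV A : \det A = 1 -> rho (invmx A) = invmx (rho A).
Proof.
move=> dA; apply: (can_inj (mulKmx (rho_unit dA))).
by rewrite mulmxV ?rho_unit // (SL_reprV rhoP).
Qed.

Lemma atomsJ e A : \det A = 1 -> e \in atoms -> invmx (rho A) *m e *m rho A \in atoms.
Proof.
move=> dA /atomsP[Re nz he]; have uA := rho_unit dA.
have RJ' X : X \in R -> invmx (rho A) *m X *m rho A \in R.
  by move=> RX; have := RJ (det1V dA) RX; rewrite rhoV // invmxK.
rewrite inE RJ' //=; apply/andP; split.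
  apply: contra nz => /eqP h; apply/eqP.
  by rewrite -[e](mulKVmx uA) -[invmx _ *m e](mulmxK uA) h mul0mx mulmx0.
apply/forall_inP => f Rf; have /he h := RJ dA Rf.
have -> : invmx (rho A) *m e *m rho A * f =
    invmx (rho A) *m (e * (rho A *m f *m invmx (rho A))) *m rho A.
  by rewrite -!mulmxE !mulmxA mulmxKV.
by case: h => ->; rewrite ?mulmx0 ?mul0mx eqxx ?orbT.
Qed.

Lemma invmxM n (A B : 'M[K]_n) : A \in unitmx -> B \in unitmx ->
  invmx (A *m B) = invmx B *m invmx A.
Proof.
move=> uA uB; have uAB : A *m B \in unitmx by rewrite unitmx_mul uA.
by rewrite -[RHS](mulKmx uAB) (mulmxA _ (invmx B)) mulmxK // mulmxV // mulmx1.
Qed.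

(** [SL] permutes the atoms, of which there are at most [d], so it fixes each; an atom then commutes
    with [rho] and is a nonzero scalar. *)
Lemma atoms_fixed e : e \in atoms -> e = 1%:M.
Proof.
move=> ae; pose conj A (x : 'M[K]_d) := invmx (rho A) *m x *m rho A.
pose act A (x : {x | x \in atoms}) := insubd x (conj A (val x)).
have actE A x : \det A = 1 -> val (act A x) = conj A (val x).
  by move=> dA; rewrite /act val_insubd atomsJ ?(valP x).
have actP : SL_action act.
  split=> [x|A B x dA dB]; apply: val_inj; rewrite !actE ?det1 ?det_mulmx ?dA ?dB ?mulr1 //.
    by rewrite /conj rho1 invmx1 mul1mx mulmx1.
  by rewrite /conj rhoM // invmxM ?rho_unit // !mulmxA.
have cardA : (#|{: {x | x \in atoms}}| <= d)%N by rewrite card_sig card_atoms.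
have fixed := small_action actP cardA (Sub e ae).
have /cent_rho /scalar_cases : forall A, \det A = 1 -> e *m rho A = rho A *m e.
  move=> A dA; have /(congr1 val) := fixed A dA; rewrite actE //= => h.
  by rewrite -{2}h /conj !mulmxA mulmxV ?rho_unit // mul1mx.
by case=> // e0; have [_] := atomsP ae; rewrite e0 eqxx.
Qed.

(** A nonzero element of least rank is an atom, hence equals 1; so 1 is an atom, and [X = 1 * X] is
    0 or 1. *)
Lemma R_trivial X : X \in R -> X = 0 \/ X = 1%:M.
Proof.
move=> RX; pose P (e : 'M[K]_d) := (e \in R) && (e != 0).
have P1 : P 1 by rewrite /P R1 oner_neq0.
case: (arg_minnP (fun e : 'M[K]_d => \rank e) P1) => e /andP[Re nz] mine.
have ae : e \in atoms.
  rewrite inE Re nz; apply/forall_inP => f Rf.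
  have [//|nzf] := eqVneq (e * f) 0; rewrite /=.
  have := mine (e * f); rewrite /P RM // nzf => /(_ isT) le.
  have sub : (f *m e <= e)%MS := submxMl _ _.
  have : (e <= f *m e)%MS.
    by have [_ <-] := mxrank_leqif_sup sub; rewrite eqn_leq mxrankS //= -[f *m e]/(f * e) R_comm.
  case/submxP => D eD; apply/eqP.
  have eD' : D * (f * e) = e by rewrite [in RHS]eD.
  by rewrite -{1}eD' -!mulrA (R_comm Re Rf) (mulrA f) R_idem // eD'.
have e1 := atoms_fixed ae; have [_ _ h] := atomsP ae.
by have := h X RX; rewrite e1 mul1r; case; [left|right].
Qed.

End TrivialUnits.

Lemma R_very_simple : (forall X, X \in R -> is_scalar_mx X) \/ forall X, X \in R.
Proof.
have [G1|full] := Gam_cases; [left => X RX | by right].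
by case: (R_trivial G1 RX) => ->; apply/is_scalar_mxP; [exists 0 | exists 1]; rewrite ?raddf0.
Qed.

End VerySimple.

(** * The permutation module *)

Section PermutationModule.

Variable B : finType.
Local Notation N := #|B|.

Lemma permmx1 : permmx (1%g : {perm B}) = 1%:M.
Proof. by apply/matrixP => i j; rewrite !mxE perm1 (inj_eq enum_val_inj). Qed.

Lemma delta_permmx (s : {perm B}) x :
  delta_mx 0 (enum_rank x) *m permmx s = delta_mx 0 (enum_rank (s x)) :> 'rV_N.
Proof.
rewrite -rowE; apply/rowP => j; rewrite !mxE enum_rankK eqxx /=.
by rewrite -(inj_eq enum_val_inj) enum_rankK eq_sym.
Qed.

Lemma permmx_delta (s : {perm B}) x :
  permmx s *m delta_mx (enum_rank (s x)) 0 = delta_mx (enum_rank x) 0 :> 'cV_N.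
Proof.
rewrite -colE; apply/colP => j; rewrite !mxE enum_rankK eqxx andbT.
by rewrite (inj_eq perm_inj) -[in RHS](inj_eq enum_val_inj) enum_rankK.
Qed.

Lemma permmxM (s t : {perm B}) : permmx (s * t)%g = permmx s *m permmx t.
Proof.
apply/row_matrixP => i; rewrite !rowE mulmxA -[i]enum_valK !delta_permmx.
by rewrite permM.
Qed.

Lemma sum0_mxP (v : 'rV['F_2]_N) : reflect (\sum_i v 0 i = 0) (v <= sum0_mx B)%MS.
Proof.
have e : (v *m (const_mx 1 : 'cV_N)) 0 0 = \sum_i v 0 i.
  by rewrite mxE; apply: eq_bigr => i _; rewrite mxE mulr1.
apply: (iffP sub_kermxP) => [h|h]; first by rewrite -e h mxE.
by rewrite [LHS]mx11_scalar e h raddf0.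
Qed.

Variables (F : finFieldType) (k : nat) (P : 'M[F]_(1 + k) -> {perm B}).
Hypotheses (P1 : P 1%:M = 1%g)
  (PM : forall A C, \det A = 1 -> \det C = 1 -> P (A *m C) = (P A * P C)%g)
  (Ptrans : forall x y, exists2 A, \det A = 1 & P A x = y).
Variables (r : nat).
Hypotheses (k1 : (1 < k)%N) (q2 : (2 < #|F|)%N) (oddF : odd #|F|)
  (Qr : (#|F| ^ k = #|F|.-1 * r + 1)%N) (cardB : #|B| = (#|F| * r + 1)%N).

Definition perm_repr A := permmx (P A).

Lemma perm_reprP : SL_repr perm_repr.
Proof. by split=> [|A C dA dC]; rewrite /perm_repr ?P1 ?permmx1 // PM // permmxM. Qed.

Variables (K : fieldType) (iota : {rmorphism 'F_2 -> K}) (psi : F -> K).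
Hypothesis psiP : additive_char psi.

Lemma card_odd_F2 : (#|F| ^ k)%:R = 1 :> K.
Proof.
have e2 : 2%:R = 0 :> K.
  by rewrite -(rmorph_nat iota) (_ : 2%:R = 0) ?rmorph0 //; apply: val_inj.
rewrite -(odd_double_half (#|F| ^ k)) oddX oddF orbT natrD -muln2 natrM e2 mulr0 addr0.
by [].
Qed.

Section MapRepr.

Variables (a : nat) (X : 'M[F]_(1 + k) -> 'M['F_2]_a).
Hypothesis XP : SL_repr X.

Lemma map_SL_repr : SL_repr (fun A => map_mx iota (X A)).
Proof.
case: XP => X1 XM; split=> [|A C dA dC]; first by rewrite X1 map_mx1.
by rewrite XM // map_mxM.
Qed.

End MapRepr.

Let XK A := map_mx iota (perm_repr A).
Let XKP : SL_repr XK := map_SL_repr perm_reprP.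
Let card1 := card_odd_F2.

Lemma r_gt1 : (1 < r)%N.
Proof.
have : (#|F| ^ 2 <= #|F| ^ k)%N by rewrite leq_pexp2l // (ltn_trans _ q2).
by rewrite Qr; move: q2; clear; nia.
Qed.

(** Rank 2 would require [2 * #|F|.-1 * r <= #|F| * r + 1], which fails for [#|F| > 2] and
    [r > 1]. *)
Lemma perm_proj_rank c : c != 0 -> (\rank (tau_proj XK psi c) <= 1)%N.
Proof.
move=> c0; have := tau_proj_rank_sum XKP psiP card1 k1 c0; move: (\rank _) => R.
by rewrite [X in (_ <= X)%N]cardB Qr; move: q2 r_gt1; clear; nia.
Qed.

Let XM A C : \det A = 1 -> \det C = 1 -> perm_repr (A *m C) = perm_repr A *m perm_repr C.
Proof. by case: perm_reprP => _; apply. Qed.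
Let X1 : perm_repr 1%:M = 1%:M. Proof. by case: perm_reprP. Qed.

Section Submodule.

Variable M : 'M['F_2]_N.
Hypothesis modM : forall A, \det A = 1 -> (M *m perm_repr A <= M)%MS.

Let MK : 'M[K]_N := map_mx iota M.

Let modMK A : \det A = 1 -> (MK *m XK A <= MK)%MS.
Proof. by move=> dA; rewrite -map_mxM map_submx modM. Qed.

Let MK_proj c : (MK *m tau_proj XK psi c <= MK)%MS.
Proof.
rewrite mulmx_sumr; apply: summx_sub => v _; rewrite -scalemxAr; apply: scalemx_sub.
by apply: modMK; rewrite det_tau.
Qed.

(** By conjugacy all nontrivial projectors kill [M], so the [tau v] and then [SL] fix its rows; by
    transitivity on [B] these rows are constant functions. *)
Lemma perm_submodule_trivial c : c != 0 -> MK *m tau_proj XK psi c = 0 -> (M <= ones_B B)%MS.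
Proof.
move=> c0 e.
have all0 b : b != 0 -> MK *m tau_proj XK psi b = 0.
  move=> b0; have [g dg ->] := tau_proj_conj_nz psi XKP k1 c0 b0.
  have [D eD] := submxP (modMK (A := lam g) (etrans (det_lam g) dg)).
  by rewrite !mulmxA eD -(mulmxA D) e mulmx0 mul0mx.
have e0 : MK *m tau_proj XK psi 0 = MK.
  have := @char_proj_sum _ _ _ _ _ (XK \o @tau F k) psiP card1 (SL_repr_tau0 XKP).
  move/(congr1 (mulmx MK)); rewrite mulmx1 mulmx_sumr (bigD1 0) //= => h.
  by rewrite -[RHS]h big1 ?addr0 // => b b0; apply: all0.
have tauM v : M *m perm_repr (tau v) = M.
  apply: (@map_mx_inj _ _ iota); rewrite map_mxM -/MK -[in LHS]e0 -mulmxA.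
  have -> : tau_proj XK psi 0 *m map_mx iota (perm_repr (tau v)) = tau_proj XK psi 0.
    have := @char_proj_actr _ _ _ _ _ (XK \o @tau F k) psiP (SL_repr_tauD XKP) v 0.
    by rewrite dot0l; case: psiP => -> _ _; rewrite scale1r.
  exact: e0.
have fixM : forall A, \det A = 1 -> M *m perm_repr A = M.
  apply: SL_tau_ind => [|| A C dA dC eA eC | A v dA]; first exact: ltnW.
  - by rewrite X1 mulmx1.
  - by rewrite XM // mulmxA eA.
  have dAt : \det (A *m tau v) = 1 by rewrite det_mulmx dA det_tau mulr1.
  have [D eD] := submxP (modM dA).
  rewrite !XM ?det_tau ?det1V // !mulmxA eD -(mulmxA D) tauM -eD -mulmxA.
  by rewrite (SL_reprV perm_reprP) // mulmx1.
have [x0 _|none] := pickP (@predT B); last first.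
  by rewrite [M](_ : _ = 0) ?sub0mx //; apply/matrixP => i j; have := none (enum_val j).
have const x : M *m delta_mx (enum_rank x) 0 = M *m delta_mx (enum_rank x0) 0 :> 'cV_N.
  have [A dA <-] := Ptrans x0 x.
  by rewrite -[in LHS](fixM A dA) -mulmxA permmx_delta.
apply/submxP; exists (M *m delta_mx (enum_rank x0) 0); apply/matrixP => i j.
have := congr1 (fun v : 'cV_N => v i 0) (const (enum_val j)).
rewrite enum_valK -!colE !mxE => ->; rewrite big_ord1 !mxE mulr1.
by [].
Qed.

(** The nontrivial projectors have rank at most 1, so [M] contains their images, hence those of
    [tau v - 1] and of [A - 1] for all [A] in [SL]. By transitivity it contains the differences of
    basis vectors, which span [sum0_mx B]. *)
Lemma perm_submodule_large : (forall c, c != 0 -> MK *m tau_proj XK psi c != 0) ->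
  (sum0_mx B <= M)%MS.
Proof.
move=> nz.
have projM c : c != 0 -> (tau_proj XK psi c <= MK)%MS.
  move=> c0; apply: submx_trans (MK_proj c).
  have sub : (MK *m tau_proj XK psi c <= tau_proj XK psi c)%MS := submxMl _ _.
  have [_ <-] := mxrank_leqif_sup sub; rewrite eqn_leq mxrankS //=.
  by apply: leq_trans (perm_proj_rank c0) _; rewrite lt0n mxrank_eq0 nz.
have tauM v : (perm_repr (tau v) - 1%:M <= M)%MS.
  rewrite -(map_submx iota) map_mxB map_mx1.
  have sum1 := @char_proj_sum _ _ _ _ _ (XK \o @tau F k) psiP card1 (SL_repr_tau0 XKP).
  rewrite -[map_mx iota _]mulmx1 -sum1 mulmx_sumr -sumrB; apply: summx_sub => c _.
  have := @char_proj_actl _ _ _ _ _ (XK \o @tau F k) psiP (SL_repr_tauD XKP) v c.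
  rewrite -[(_ \o _) v]/(map_mx iota (perm_repr (tau v))) => ->.
  rewrite -[X in _ - X]scale1r -scalerBl; have [->|c0] := eqVneq c 0.
    by rewrite dot0l; case: psiP => -> _ _; rewrite subrr scale0r sub0mx.
  by apply: scalemx_sub; apply: projM.
have allM : forall A, \det A = 1 -> (perm_repr A - 1%:M <= M)%MS.
  apply: SL_tau_ind => [|| A C dA dC eA eC | A v dA]; first exact: ltnW.
  - by rewrite X1 subrr sub0mx.
  - have -> : perm_repr (A *m C) - 1%:M =
        perm_repr A *m (perm_repr C - 1%:M) + (perm_repr A - 1%:M).
      by rewrite XM // mulmxBr mulmx1 addrA subrK.
    by rewrite addmx_sub ?mulmx_sub.
  have dAt : \det (A *m tau v) = 1 by rewrite det_mulmx dA det_tau mulr1.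
  have -> : perm_repr (A *m tau v *m invmx A) - 1%:M =
      perm_repr A *m ((perm_repr (tau v) - 1%:M) *m perm_repr (invmx A)).
    rewrite mulmxBl mul1mx mulmxBr -(SL_reprV perm_reprP dA) !XM ?det_tau ?det1V //.
    by rewrite -!mulmxA.
  apply: mulmx_sub; apply: submx_trans (submxMr _ (tauM v)) _.
  by apply: modM; apply: det1V.
apply/rV_subP => v /sum0_mxP sv.
have [x0 _|none] := pickP (@predT B); last first.
  by rewrite [v](_ : _ = 0) ?sub0mx //; apply/rowP => j; have := none (enum_val j).
rewrite [v]row_sum_delta.
have -> : \sum_j v 0 j *: delta_mx 0 j =
    \sum_j v 0 j *: (delta_mx 0 j - delta_mx 0 (enum_rank x0)) :> 'rV_N.
  rewrite [RHS](eq_bigr (fun j => v 0 j *: delta_mx 0 j - v 0 j *: delta_mx 0 (enum_rank x0))).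
    by rewrite sumrB -scaler_suml sv scale0r subr0.
  by move=> j _; rewrite scalerBr.
apply: summx_sub => j _; apply: scalemx_sub.
have [A dA e] := Ptrans x0 (enum_val j).
have -> : delta_mx 0 j - delta_mx 0 (enum_rank x0) =
    delta_mx 0 (enum_rank x0) *m (perm_repr A - 1%:M) :> 'rV_N.
  by rewrite mulmxBr mulmx1 delta_permmx e enum_valK.
by apply: mulmx_sub; apply: allM.
Qed.

Lemma perm_submodule : (M <= ones_B B)%MS \/ (sum0_mx B <= M)%MS.
Proof.
have [c /andP[c0 /eqP e]|none] := pickP [pred c | (c != 0) && (MK *m tau_proj XK psi c == 0)].
  by left; apply: perm_submodule_trivial c0 e.
right; apply: perm_submodule_large => c c0.
by have /= := none c; rewrite c0 => /negbT.
Qed.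

End Submodule.

End PermutationModule.

(** * The centralizer when the projectors have rank one *)

Section Centralizer.

Variables (F F2 : finFieldType) (k : nat) (d : nat) (rho : 'M[F]_(1 + k) -> 'M[F2]_d).
Hypothesis F2P : forall x : F2, x = 0 \/ x = 1.
Variables (K : fieldType) (iota : {rmorphism F2 -> K}) (psi : F -> K).
Hypotheses (k1 : (1 < k)%N) (d1 : (1 < d)%N) (psiP : additive_char psi).
Hypothesis card1 : (#|F| ^ k)%:R = 1 :> K.
Hypothesis rhoP : SL_repr rho.
Hypothesis irr : forall U : 'M[F2]_d,
  (forall A, \det A = 1 -> (U *m rho A <= U)%MS) -> U != 0 -> row_full U.
Let rhoK A : 'M[K]_d := map_mx iota (rho A).
Let E := tau_proj rhoK psi.
Hypothesis rank1 : forall c, c != 0 -> (\rank (E c) <= 1)%N.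

Let rhoKP : SL_repr rhoK.
Proof.
case: rhoP => X1 XM; split=> [|A C dA dC]; first by rewrite /rhoK X1 map_mx1.
by rewrite /rhoK XM // map_mxM.
Qed.

Let E_neq0 c : c != 0 -> E c != 0.
Proof.
move=> c0; apply/eqP => e; have triv := SL_repr_trivial rhoKP psiP card1 k1 c0 e.
pose U : 'M[F2]_d := delta_mx (Ordinal (ltnW d1)) (Ordinal (ltnW d1)).
have /irr : forall A, \det A = 1 -> (U *m rho A <= U)%MS.
  move=> A dA; have -> : rho A = 1%:M by apply: (@map_mx_inj _ _ iota); rewrite map_mx1; apply: triv.
  by rewrite mulmx1.
rewrite -mxrank_eq0 mxrank_delta => /(_ isT); rewrite /row_full mxrank_delta => /eqP d1'.
by move: d1; rewrite -d1'.
Qed.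

(** On the rank one image of [E c0], [f] is a scalar [lambda], and by conjugation the same [lambda]
    serves every nontrivial character, hence the row space of [Y = rho (tau v) - 1]. Once [lambda]
    is known to come from [F2], the kernel of [f - lambda] is a nonzero submodule. *)
Lemma SL_cent_scalar f : (forall A, \det A = 1 -> f *m rho A = rho A *m f) -> is_scalar_mx f.
Proof.
move=> cf; pose fK := map_mx iota f.
have cfK A : \det A = 1 -> fK *m rhoK A = rhoK A *m fK by move=> dA; rewrite -!map_mxM cf.
have cfE c : E c *m fK = fK *m E c.
  rewrite /E /tau_proj /char_proj mulmx_suml mulmx_sumr; apply: eq_bigr => v _.
  by rewrite -scalemxAl -scalemxAr cfK ?det_tau.
have [c0 c0n] : exists c : 'rV[F]_k, c != 0.
  exists (delta_mx 0 (Ordinal (ltnW k1))).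
  by apply/eqP => /matrixP/(_ 0 (Ordinal (ltnW k1)))/eqP; rewrite !mxE !eqxx oner_eq0.
have [lambda lE0] : exists l, E c0 *m fK = l *: E c0.
  have nz := E_neq0 c0n; pose u := nz_row (E c0).
  have Eu : (E c0 <= u)%MS.
    have [_ <-] := mxrank_leqif_sup (nz_row_sub (E c0)).
    rewrite eqn_leq mxrankS ?nz_row_sub //=; apply: leq_trans (rank1 c0n) _.
    by rewrite lt0n mxrank_eq0 nz_row_eq0.
  have /sub_rVP [l el] : (u *m fK <= u)%MS.
    apply: submx_trans (submxMr fK (nz_row_sub _)) _; rewrite cfE.
    exact: submx_trans (submxMl _ _) Eu.
  by exists l; have /submxP [D eD] := Eu; rewrite {1}eD -mulmxA el -scalemxAr -eD.
have lE c : c != 0 -> E c *m fK = lambda *: E c.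
  move=> cn; have [g dg eE] := tau_proj_conj_nz psi rhoKP k1 c0n cn.
  have dl : \det (lam g) = 1 by rewrite det_lam.
  have uX : rhoK (lam g) \in unitmx := SL_repr_unit rhoKP dl.
  have cV : invmx (rhoK (lam g)) *m fK = fK *m invmx (rhoK (lam g)).
    apply: (can_inj (mulKmx uX)); rewrite mulKVmx // mulmxA -cfK //.
    by rewrite mulmxK.
  rewrite -[E c]/(tau_proj rhoK psi c) eE -[tau_proj _ _ c0]/(E c0).
  by rewrite -mulmxA cV mulmxA -(mulmxA _ _ fK) lE0 -scalemxAr -scalemxAl.
have sum1 := @char_proj_sum _ _ _ _ _ (rhoK \o @tau F k) psiP card1 (SL_repr_tau0 rhoKP).
have actl v c : rhoK (tau v) *m E c = psi (dot c v) *: E c.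
  exact: (@char_proj_actl _ _ _ _ _ (rhoK \o @tau F k) psiP (SL_repr_tauD rhoKP) v c).
have [v nv] : exists v, rho (tau v) - 1%:M != 0.
  have [_ _ [x nx]] := psiP; have [v ev] := dot_surjr x c0n.
  exists v; rewrite subr_eq0; apply: contra nx => /eqP e; apply/eqP.
  have := actl v c0; rewrite /rhoK e map_mx1 mul1mx ev => h.
  have /eqP : (psi x - 1) *: E c0 = 0 by rewrite scalerBl scale1r -h subrr.
  by rewrite scaler_eq0 (negbTE (E_neq0 c0n)) orbF subr_eq0 => /eqP.
pose Y := rho (tau v) - 1%:M.
have lY : map_mx iota Y *m fK = lambda *: map_mx iota Y.
  have -> : map_mx iota Y = \sum_c (psi (dot c v) - 1) *: E c.
    rewrite map_mxB map_mx1 -[map_mx iota _]mulmx1 -sum1 mulmx_sumr -sumrB.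
    by apply: eq_bigr => c _; rewrite [X in X - _]actl scalerBl scale1r.
  rewrite mulmx_suml scaler_sumr; apply: eq_bigr => c _; rewrite -scalemxAl scalerA mulrC -scalerA.
  have [->|cn] := eqVneq c 0; last by rewrite lE.
  by rewrite dot0l; case: psiP => -> _ _; rewrite subrr !scale0r.
have [i [j nij]] : exists i j, Y i j != 0.
  have [[i j] /= nij|h] := pickP [pred p : 'I_d * 'I_d | Y p.1 p.2 != 0]; first by exists i, j.
  by case/eqP: nv; apply/matrixP => i j; have /negbFE/eqP /= e := h (i, j); rewrite [RHS]mxE.
have Yij : Y i j = 1 by case: (F2P (Y i j)) nij => // ->; rewrite eqxx.
(* Where [Y] has the entry 1, the matrix [Y *m f] has the entry [lambda], so [lambda] is defined
   over [F2]. *)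
pose l := (Y *m f) i j.
have el : lambda = iota l.
  have := congr1 (fun Z : 'M_d => Z i j) lY; rewrite -map_mxM [LHS]mxE => ->.
  by rewrite [RHS]mxE [X in _ = _ * X]mxE Yij rmorph1 mulr1.
have Yf : Y *m (f - l%:M) = 0.
  apply: (@map_mx_inj _ _ iota); rewrite map_mxM [map_mx iota (f - _)]map_mxB map_scalar_mx map_mx0.
  by rewrite mulmxBr lY mul_mx_scalar el subrr.
have /irr : forall A, \det A = 1 -> (kermx (f - l%:M) *m rho A <= kermx (f - l%:M))%MS.
  move=> A dA; apply/sub_kermxP; rewrite -mulmxA.
  have -> : rho A *m (f - l%:M) = (f - l%:M) *m rho A.
    by rewrite mulmxBr mulmxBl cf // scalar_mxC.
  by rewrite mulmxA mulmx_ker mul0mx.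
have kn : kermx (f - l%:M) != 0.
  apply: contra nv => /eqP e; have /sub_kermxP := Yf; rewrite e.
  by rewrite submx0.
move=> /(_ kn); rewrite -sub1mx => /sub_kermxP; rewrite mul1mx => /eqP; rewrite subr_eq0 => /eqP ->.
exact: scalar_mx_is_scalar.
Qed.

End Centralizer.

(** The projector is linear in the representation, so its rank does not increase on a submodule or a
    quotient. *)
Lemma tau_proj_compress (F : finFieldType) (K : fieldType) k n d (psi : F -> K)
    (X : 'M[F]_(1 + k) -> 'M[K]_n) (Y : 'M[F]_(1 + k) -> 'M[K]_d) (L : 'M_(d, n)) (R : 'M_(n, d)) c :
  (forall A, Y A = L *m X A *m R) -> (\rank (tau_proj Y psi c) <= \rank (tau_proj X psi c))%N.
Proof.
move=> h; have -> : tau_proj Y psi c = L *m tau_proj X psi c *m R.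
  rewrite /tau_proj /char_proj mulmx_sumr mulmx_suml; apply: eq_bigr => v _.
  by rewrite /= h -scalemxAr -scalemxAl.
by apply: leq_trans (mxrankM_maxl _ _) _; apply: mxrankM_maxr.
Qed.

(** * Submodules and quotients of representations of SL *)

Section Subquotient.

Variables (F : finFieldType) (k : nat) (K : fieldType) (n : nat).
Variables (X : 'M[F]_(1 + k) -> 'M[K]_n) (U : 'M[K]_n).
Hypothesis XP : SL_repr X.
Hypothesis stU : forall A, \det A = 1 -> (U *m X A <= U)%MS.

(** The formulas of [rep_sum0] and [rep_sum0_mod1], so that these are instances by conversion. *)
Definition sub_repr A := in_submod U (val_submod (U := U) 1%:M *m X A).
Definition fact_repr A := in_factmod U (val_factmod (U := U) 1%:M *m X A).

Lemma stable_submx m (W : 'M_(m, n)) A : \det A = 1 -> (W <= U)%MS -> (W *m X A <= U)%MS.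
Proof. by move=> dA sWU; rewrite (submx_trans (submxMr _ sWU)) ?stU. Qed.

Lemma val_sub_repr m (W : 'M_(m, \rank U)) A : \det A = 1 ->
  val_submod (W *m sub_repr A) = val_submod W *m X A.
Proof.
move=> dA; rewrite /sub_repr in_submodE (mulmxA W) (mulmxA W) -val_submodE -in_submodE.
by rewrite in_submodK // stable_submx ?val_submodP.
Qed.

Lemma in_fact_repr m (W : 'M_(m, n)) A : \det A = 1 ->
  in_factmod U W *m fact_repr A = in_factmod U (W *m X A).
Proof.
move=> dA; rewrite /fact_repr (in_factmodE _ (_ *m X A)) (mulmxA (in_factmod U W)).
rewrite (mulmxA (in_factmod U W)) -val_factmodE -in_factmodE.
rewrite -[in RHS](add_sub_fact_mod U W) mulmxDl linearD /=.
rewrite [X in _ = X + _](_ : _ = 0) ?add0r //.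
by apply/eqP; rewrite in_factmod_eq0 stable_submx ?val_submodP.
Qed.

Lemma sub_reprP : SL_repr sub_repr.
Proof.
case: XP => X1 XM; split=> [|A B dA dB]; first by rewrite /sub_repr X1 mulmx1 val_submodK.
apply: (@val_submod_inj _ _ U); rewrite val_sub_repr // /sub_repr.
by rewrite !in_submodK ?stable_submx ?val_submodP ?det_mulmx ?dA ?dB ?mulr1 // XM // mulmxA.
Qed.

Lemma fact_reprP : SL_repr fact_repr.
Proof.
case: XP => X1 XM; split=> [|A B dA dB]; first by rewrite /fact_repr X1 mulmx1 val_factmodK.
by rewrite /fact_repr XM // mulmxA -in_fact_repr.
Qed.

Lemma val_sub_stable m (W : 'M_(m, \rank U)) :
    (forall A, \det A = 1 -> (W *m sub_repr A <= W)%MS) ->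
  forall A, \det A = 1 -> (val_submod W *m X A <= val_submod W)%MS.
Proof. by move=> stW A dA; rewrite -val_sub_repr // val_submodS stW. Qed.

Lemma val_fact_stable m (W : 'M_(m, \rank (cokermx U))) :
    (forall A, \det A = 1 -> (W *m fact_repr A <= W)%MS) ->
  forall A, \det A = 1 -> ((U + val_factmod W)%MS *m X A <= U + val_factmod W)%MS.
Proof.
move=> stW A dA; rewrite addsmxMr addsmx_sub.
rewrite (submx_trans (stU dA) (addsmxSl _ _)) /=.
rewrite -[val_factmod W *m X A](add_sub_fact_mod U) addmx_sub_adds ?val_submodP //.
by rewrite -in_fact_repr // val_factmodK val_factmodS stW.
Qed.

Lemma val_submod_full (W : 'M_(\rank U)) : (U <= val_submod W)%MS -> row_full W.
Proof. by rewrite -sub1mx -(val_submodS _ W) val_submod1. Qed.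

Lemma val_factmod_full (W : 'M_(\rank (cokermx U))) : row_full (U + val_factmod W)%MS -> row_full W.
Proof.
move=> full; have : (in_factmod U (val_factmod (U := U) 1%:M)
    <= in_factmod U (U + val_factmod W)%MS)%MS by apply/submxMr/submx_full.
by rewrite in_factmod_addsK !val_factmodK sub1mx.
Qed.

Lemma val_factmod_sub0 m (W : 'M_(m, \rank (cokermx U))) : (val_factmod W <= U)%MS -> W = 0.
Proof. by rewrite -in_factmod_eq0 val_factmodK => /eqP. Qed.

End Subquotient.

(** Bridges [very_simple], which quantifies over predicates in [Prop], and the finite sets of the
    previous sections. *)
Lemma prop_finset (T : finType) (R : T -> Prop) : exists S : {set T}, forall x, (x \in S) <-> R x.
Proof.
exists [set x | if excluded_middle_informative (R x) then true else false] => x.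
by rewrite inE; case: (excluded_middle_informative (R x)).
Qed.

Lemma F2_rank1_very_simple (F : finFieldType) k r (K : fieldType) (iota : {rmorphism 'F_2 -> K})
    (psi : F -> K) (gT : finGroupType) (G : {set gT}) (P : 'M[F]_(1 + k) -> gT) d (rr : gT -> 'M['F_2]_d) :
    (1 < k)%N -> odd #|F| -> (2%:R != 0 :> F) -> (#|F| ^ k = #|F|.-1 * r + 1)%N ->
    additive_char psi -> (forall A, \det A = 1 -> P A \in G) ->
    (1 < d)%N -> (d <= #|F| * r)%N -> SL_repr (fun A => rr (P A)) ->
    (forall U : 'M_d, (forall A, \det A = 1 -> (U *m rr (P A) <= U)%MS) -> U != 0 -> row_full U) ->
    (forall c, c != 0 -> (\rank (tau_proj (fun A => map_mx iota (rr (P A))) psi c) <= 1)%N) ->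
  very_simple G rr.
Proof.
move=> k1 oddF two Qr psiP PG; case: d rr => // d' rr d1 dqr rhoP irr rank1 R R1 RD RZ RM RJ.
have q2 : (2 < #|F|)%N.
  by have := @finNzRing_gt1 F; move: oddF; case: #|F| => [|[|[|?]]].
have [S SP] := prop_finset R.
have small_action X act : @SL_action F k X act -> (#|X| <= d'.+1)%N ->
    forall A x, \det A = 1 -> act A x = x.
  by move=> actP cX A x dA; apply: (SL_action_trivial k1 q2 two Qr _ actP x dA); apply: leq_trans dqr.
have small_repr a (X : 'M[F]_(1 + k) -> 'M['F_2]_a) : SL_repr X -> (a + a <= d'.+1)%N ->
    forall A, \det A = 1 -> X A = 1%:M.
  move=> XP aa A dA; apply: (@map_mx_inj _ _ iota); rewrite map_mx1.
  apply: (SL_repr_degree (map_SL_repr iota XP) psiP (card_odd_F2 k oddF iota) k1 _ dA).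
  (* Half of [#|F| * r] is less than [#|F|.-1 * r], the bound on degrees. *)
  by rewrite Qr; case: (#|F|) q2 dqr => [|[|[|q]]] //=; case: (r) => [|r'] _ /=; nia.
have cent := SL_cent_scalar F2_cases k1 d1 psiP (card_odd_F2 k oddF iota) rhoP irr rank1.
have := @R_very_simple F 'F_2 k d' F2_cases _ k1 two rhoP irr cent small_action small_repr S.
case.
- exact/SP.
- by move=> A B /SP RA /SP RB; apply/SP; apply: RD.
- by move=> A B /SP RA /SP RB; apply/SP; apply: RM.
- by move=> A X dA /SP RX; apply/SP; apply: RJ => //; apply: PG.
- move=> Rs; left=> A; split=> [/SP/Rs/is_scalar_mxP[a ->]|[a ->]]; first by exists a.
  by rewrite -scalemx1; apply: RZ.
- by move=> Rs; right=> A; apply/SP; apply: Rs.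
Qed.

(** * Very simplicity of the module on B *)

Section QuotientModule.

Variable B : finType.
Local Notation N := #|B|.

Lemma permmx_const (s : {perm B}) : permmx s *m (const_mx 1 : 'cV_N) = const_mx 1.
Proof.
apply/colP => i; rewrite !mxE (bigD1 (enum_rank (s (enum_val i)))) //= !mxE enum_rankK eqxx mulr1.
rewrite big1 ?addr0 // => j; rewrite !mxE mulr1 -(inj_eq enum_val_inj) enum_rankK eq_sym.
by move/negbTE->.
Qed.

Lemma ones_permmx (s : {perm B}) : ones_B B *m permmx s = ones_B B.
Proof.
apply/rowP => j; rewrite !mxE (bigD1 (enum_rank (s^-1%g (enum_val j)))) //= !mxE enum_rankK permKV eqxx mulr1.
rewrite big1 ?addr0 // => i; rewrite !mxE mul1r -(inj_eq enum_val_inj) enum_rankK.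
by rewrite -(inj_eq (@perm_inj _ s)) permKV => /negbTE->.
Qed.

Lemma sum0_permmx (s : {perm B}) : (sum0_mx B *m permmx s <= sum0_mx B)%MS.
Proof. by apply/sub_kermxP; rewrite -mulmxA permmx_const mulmx_ker. Qed.

Lemma rank_sum0_mx : (0 < N)%N -> \rank (sum0_mx B) = N.-1.
Proof.
move=> N0; rewrite mxrank_ker -subn1; congr (_ - _)%N; apply/eqP.
rewrite eqn_leq rank_leq_col lt0n mxrank_eq0 /=.
by apply/eqP => /colP/(_ (Ordinal N0)); rewrite !mxE.
Qed.

Lemma ones_sum0 : (ones_B B <= sum0_mx B)%MS = ~~ odd N.
Proof.
have e : (N%:R == 0 :> 'F_2) = ~~ odd N by rewrite -(dvdn_pcharf (@pchar_Fp 2 isT)) dvdn2.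
by rewrite -e; apply/sum0_mxP/eqP; under eq_bigr do rewrite mxE; rewrite sumr_const card_ord.
Qed.

Variables (F : finFieldType) (k : nat) (P : 'M[F]_(1 + k) -> {perm B}).
Hypotheses (P1 : P 1%:M = 1%g)
  (PM : forall A C, \det A = 1 -> \det C = 1 -> P (A *m C) = (P A * P C)%g)
  (Ptrans : forall x y, exists2 A, \det A = 1 & P A x = y).
Variables (r : nat).
Hypotheses (k1 : (1 < k)%N) (two : 2%:R != 0 :> F) (oddF : odd #|F|)
  (Qr : (#|F| ^ k = #|F|.-1 * r + 1)%N) (cardB : #|B| = (#|F| * r + 1)%N).
Variables (K : fieldType) (iota : {rmorphism 'F_2 -> K}) (psi : F -> K).
Hypothesis psiP : additive_char psi.
Variable G : {set {perm B}}.
Hypothesis PG : forall A, \det A = 1 -> P A \in G.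

Let q2 : (2 < #|F|)%N.
Proof. by have := @finNzRing_gt1 F; move: oddF; case: #|F| => [|[|[|?]]]. Qed.

Let X := perm_repr P.
Let XP : SL_repr X := perm_reprP P1 PM.
Let Y A := rep_sum0 (P A).

Let stable_sum0 A : \det A = 1 -> (sum0_mx B *m X A <= sum0_mx B)%MS.
Proof. by move=> _; apply: sum0_permmx. Qed.

Let YP : SL_repr Y := sub_reprP XP stable_sum0.

Let rank_sum0 : \rank (sum0_mx B) = (#|F| * r)%N.
Proof. by rewrite rank_sum0_mx cardB addn1. Qed.

Let qr_gt2 : (2 < #|F| * r)%N.
Proof. by have := r_gt1 k1 q2 Qr; move: q2; clear; nia. Qed.

Let rankX c : c != 0 -> (\rank (tau_proj (fun A => map_mx iota (X A)) psi c) <= 1)%N.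
Proof. exact: (perm_proj_rank P1 PM k1 q2 oddF Qr cardB iota psiP). Qed.

Let rankY c : c != 0 -> (\rank (tau_proj (fun A => map_mx iota (Y A)) psi c) <= 1)%N.
Proof.
move=> /rankX; apply: leq_trans.
apply: (@tau_proj_compress _ _ _ _ _ _ _ _ (map_mx iota (val_submod (U := sum0_mx B) 1%:M))
   (map_mx iota (in_submod (sum0_mx B) 1%:M))) => A.
by rewrite -!map_mxM -in_submodE.
Qed.

Let submoduleX m (V : 'M_(m, N)) : (forall A, \det A = 1 -> (V *m X A <= V)%MS) ->
  (V <= ones_B B)%MS \/ (sum0_mx B <= V)%MS.
Proof.
move=> stV; have stM A : \det A = 1 -> (<<V>> *m X A <= <<V>>)%MS.
  by move=> dA; rewrite (eqmxMr _ (genmxE V)) genmxE stV.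
have := perm_submodule P1 PM Ptrans k1 q2 oddF Qr cardB iota psiP stM.
by rewrite !genmxE.
Qed.

(** For odd [N] the constant 1 is not in [sum0_mx B], so a submodule of [sum0_mx B] made of
    constants is zero. *)
Lemma rep_sum0_very_simple : odd N -> very_simple G (@rep_sum0 B).
Proof.
move=> oddB; apply: (F2_rank1_very_simple k1 oddF two Qr psiP PG) YP _ rankY; rewrite ?rank_sum0 //.
  exact: ltnW.
move=> U stU U0; apply: val_submod_full.
have stV : forall A, \det A = 1 -> (val_submod U *m X A <= val_submod U)%MS.
  exact: val_sub_stable stable_sum0 _ _ stU.
have [leV|//] := submoduleX stV.
case/negP: U0; rewrite -val_submod_eq0; apply: contraLR oddB => /rowV0Pn[v].
move=> vV v0; rewrite -ones_sum0.
have /sub_rVP[a va] := submx_trans vV leV.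
suff -> : ones_B B = v by rewrite (submx_trans vV) ?val_submodP.
by case: (F2_cases a) va v0 => -> ->; rewrite ?scale0r ?eqxx ?scale1r.
Qed.

Section EvenDegree.

Hypothesis evenB : ~~ odd N.

Let ones0 : (ones_B B <= sum0_mx B)%MS. Proof. by rewrite ones_sum0. Qed.
Let L := ones_in_sum0 B.
Let Z A := rep_sum0_mod1 (P A).

Let stable_ones A : \det A = 1 -> (L *m Y A <= L)%MS.
Proof.
move=> dA; rewrite (eqmxMr _ (genmxE _)) genmxE -val_submodS.
by rewrite (val_sub_repr stable_sum0) // in_submodK // ones_permmx.
Qed.

Let ZP : SL_repr Z := fact_reprP YP stable_ones.

Let rankZ c : c != 0 -> (\rank (tau_proj (fun A => map_mx iota (Z A)) psi c) <= 1)%N.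
Proof.
move=> /rankY; apply: leq_trans.
apply: (@tau_proj_compress _ _ _ _ _ _ _ _ (map_mx iota (val_factmod (U := L) 1%:M))
   (map_mx iota (in_factmod L 1%:M))) => A.
by rewrite -!map_mxM -in_factmodE.
Qed.

Let dimZ : (#|F| * r - 1 <= \rank (cokermx L) <= #|F| * r)%N.
Proof.
by rewrite mxrank_coker -rank_sum0 leq_subr leq_sub2l // genmxE rank_leq_row.
Qed.

(** A submodule of the quotient is pulled back to the space of functions on [B]: either it consists
    of constants, and its image is zero, or it contains [sum0_mx B]. *)
Lemma rep_sum0_mod1_very_simple : very_simple G (@rep_sum0_mod1 B).
Proof.
apply: (F2_rank1_very_simple k1 oddF two Qr psiP PG) ZP _ rankZ; case/andP: dimZ => //.
  by move=> le _; apply: leq_trans le; rewrite ltn_subRL.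
move=> _ _ U stU U0; apply: val_factmod_full.
have stT := val_fact_stable stable_ones stU.
apply: val_submod_full.
have [leV|//] := submoduleX (val_sub_stable stable_sum0 stT).
case/eqP: U0; apply: (@val_factmod_sub0 _ _ L).
apply: submx_trans (addsmxSr L _) _; rewrite genmxE -val_submodS.
by rewrite in_submodK.
Qed.

End EvenDegree.

Theorem SL_QB_very_simple : QB_very_simple G.
Proof.
rewrite /QB_very_simple; case: ifP => oddB; first exact: rep_sum0_very_simple.
by apply: rep_sum0_mod1_very_simple; rewrite oddB.
Qed.

End QuotientModule.

(** * Permutation groups containing PSL *)

Section ProjectiveSpecialLinear.

Variables (F : finFieldType) (k : nat).
Local Notation S := (SL k.+1 F).
Hypotheses (k1 : (1 < k)%N) (two : 2%:R != 0 :> F).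

Definition GL_of (A : 'M[F]_(1 + k)) : {'GL_k.+1[F]} := insubd (1%g : {'GL_k.+1[F]}) A.

Lemma GL_ofK A : \det A = 1 -> GLval (GL_of A) = A.
Proof. by move=> dA; apply: (insubdK (1%g : {'GL_k.+1[F]})); apply: det1_unit. Qed.

Lemma GL_of_SL A : \det A = 1 -> GL_of A \in S.
Proof. by move=> dA; rewrite inE GL_ofK // dA. Qed.

Lemma GL_ofM A C : \det A = 1 -> \det C = 1 -> GL_of (A *m C) = (GL_of A * GL_of C)%g.
Proof.
move=> dA dC; apply: val_inj; change (GLval (GL_of (A *m C)) = GLval (GL_of A * GL_of C)%g).
rewrite GL_MxE.
have dAC : \det (A *m C) = 1 by rewrite det_mulmx dA dC mulr1.
by rewrite [LHS](GL_ofK dAC) !GL_ofK.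
Qed.

Lemma GL_of1 : GL_of 1%:M = 1%g.
Proof. by apply: val_inj; rewrite [LHS](GL_ofK (det1 _ _)). Qed.

(** [tau v] does not commute with [lam g] when [g *m v = v + v]; this makes the map from [SL] to
    [PSL] nontrivial. *)
Lemma SL_not_central : exists2 A : 'M[F]_(1 + k), \det A = 1 & GL_of A \notin 'Z(S)%g.
Proof.
have [v v0] : exists v : 'cV[F]_k, v != 0.
  by case: (k) k1 => // k' _; exists (const_mx 1); apply/cV0Pn; exists 0; rewrite mxE oner_neq0.
exists (tau v); first exact: det_tau.
apply/negP => /centerP[_ cS].
have v2 : v + v != 0 by rewrite -mulr2n -scaler_nat scaler_eq0 negb_or two v0.
have [g dg gv] := SL_trans_col k1 v0 v2.
have dl : \det (lam g) = 1 by rewrite det_lam.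
have := congr1 (@GLval _ _) (cS _ (GL_of_SL dl)); rewrite !GL_MxE !GL_ofK ?det_tau // => e.
have := lam_tau g v; rewrite gv -[LHS]e => /(can_inj (mulmxK (det1_unit dl))).
rewrite tauD -[LHS]mulmx1 => /(can_inj (mulKmx (det1_unit (det_tau v)))).
by rewrite scalar_mx_block => /eq_block_mx[_ _ /esym/eqP]; rewrite (negPf v0).
Qed.

Variables (B : finType) (H : {group {perm B}}).
Hypothesis isoH : (H \isog PSL k.+1 F)%g.

Lemma PSL_perm_hom : exists P : 'M[F]_(1 + k) -> {perm B},
  [/\ P 1%:M = 1%g,
      forall A C, \det A = 1 -> \det C = 1 -> P (A *m C) = (P A * P C)%g,
      forall A, \det A = 1 -> P A \in H
    & exists2 A, \det A = 1 & P A != 1%g].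
Proof.
have /isogP[f injf imf] : (PSL k.+1 F \isog H)%g by rewrite isog_sym.
have nZ A : \det A = 1 -> GL_of A \in 'N('Z(S))%g.
  by move=> dA; apply: (subsetP (gFnorm _ _)); apply: GL_of_SL.
have inP A : \det A = 1 -> coset 'Z(S)%g (GL_of A) \in PSL k.+1 F.
  by move=> dA; rewrite mem_quotient // GL_of_SL.
exists (fun A => f (coset 'Z(S)%g (GL_of A))); split.
- by rewrite GL_of1 (morph1 (coset _)) morph1.
- by move=> A C dA dC; rewrite GL_ofM // morphM ?nZ //= morphM ?inP.
- by move=> A dA; rewrite -imf mem_morphim ?inP.
- have [A dA nA] := SL_not_central; exists A => //.
  apply: contra nA => /eqP fA; apply: coset_idr; first exact: nZ.
  by apply: (injmP injf); rewrite ?inP ?group1 // morph1.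
Qed.

End ProjectiveSpecialLinear.

(** The orbit of a moved point carries a nontrivial action, so it has more than [#|F| * r] points,
    hence is all of [B]. *)
Lemma SL_perm_transitive (F : finFieldType) k r (B : finType) (P : 'M[F]_(1 + k) -> {perm B}) :
    (1 < k)%N -> (2 < #|F|)%N -> (2%:R != 0 :> F) -> (#|F| ^ k = #|F|.-1 * r + 1)%N ->
    #|B| = (#|F| * r + 1)%N -> P 1%:M = 1%g ->
    (forall A C, \det A = 1 -> \det C = 1 -> P (A *m C) = (P A * P C)%g) ->
    (exists2 A, \det A = 1 & P A != 1%g) ->
  forall x y, exists2 A, \det A = 1 & P A x = y.
Proof.
move=> k1 q2 two Qr cardB P1 PM [A0 dA0 nt].
have [x0 nx0] : exists x, P A0 x != x.
  by apply/existsP; rewrite -negb_forall; apply: contra nt => /forallP h; apply/eqP/permP => x; rewrite perm1 (eqP (h x)).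
pose O := [set y | [exists A : 'M[F]_(1 + k), (\det A == 1) && (P A x0 == y)]].
have OP y : reflect (exists2 A, \det A = 1 & P A x0 = y) (y \in O).
  rewrite inE; apply: (iffP existsP) => [[A /andP[/eqP ? /eqP ?]]|[A dA <-]]; first by exists A.
  by exists A; rewrite dA !eqxx.
have stO A y : \det A = 1 -> y \in O -> P A y \in O.
  move=> dA /OP[C dC <-]; apply/OP; exists (C *m A); first by rewrite det_mulmx dC dA mulr1.
  by rewrite PM // permM.
pose act A (y : {y | y \in O}) : {y | y \in O} := insubd y (P A (val y)).
have val_act A y : \det A = 1 -> val (act A y) = P A (val y).
  by move=> dA; rewrite val_insubd stO // (valP y).
have actP : SL_action act.
  split=> [y|A C y dA dC]; apply: val_inj; first by rewrite val_act ?det1 // P1 perm1.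
  by rewrite !val_act ?det_mulmx ?dA ?dC ?mulr1 // PM // permM.
have [small|large] := leqP #|O| (#|F| * r).
  have x0O : x0 \in O by apply/OP; exists 1%:M; rewrite ?det1 // P1 perm1.
  have cO : (#|{: {y | y \in O}}| <= #|F| * r)%N by rewrite card_sig.
  have := SL_action_trivial k1 q2 two Qr cO actP (Sub x0 x0O) dA0.
  by move/(congr1 val); rewrite val_act //= => e; rewrite e eqxx in nx0.
have OT y : y \in O.
  have /eqP -> : O == [set: B] by rewrite eqEcard subsetT cardsT cardB addn1.
  by rewrite inE.
move=> x y; have /OP[A dA <-] := OT x; have /OP[C dC <-] := OT y.
have dA' : \det (invmx A) = 1 by rewrite det1V.
exists (invmx A *m C); first by rewrite det_mulmx dA' dC mulr1.
rewrite PM // permM; congr (P C _).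
by rewrite -permM -PM // mulmxV ?P1 ?perm1 ?det1_unit.
Qed.

Theorem theorem3p8 (q m : nat) (F : finFieldType) (B : finType)
    (G : {group {perm B}}) :
  (exists p k : nat, [/\ prime p, odd p, (0 < k)%N & q = (p ^ k)%N]) ->
  #|F| = q ->
  (2 < m)%N ->
  #|B| = ((q ^ m - 1) %/ (q - 1))%N ->
  (exists H : {group {perm B}}, H \subset G /\ (H \isog PSL m F)%g) ->
  QB_very_simple G.
Proof.
case=> p [e [pp oddp e0 qE]] cardF; case: m => // k; rewrite ltnS => k1 cardB [H [sHG isoH]].
have pF : p \in [pchar F] by apply: (card_finPcharP _ pp); rewrite cardF qE.
have oddF : odd #|F| by rewrite cardF qE oddX oddp orbT.
have two : 2%:R != 0 :> F.
  by rewrite -(dvdn_pcharf pF) dvdn_prime2 //; apply: contraL oddp => /eqP->.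
have q2 : (2 < #|F|)%N by have := @finNzRing_gt1 F; move: oddF; case: #|F| => [|[|[|?]]].
(* [r = 1 + q + ... + q^(k-1)], so that [q^k = (q-1) r + 1] and [n = q r + 1]. *)
pose r := (\sum_(i < k) #|F| ^ i)%N.
have Qr : (#|F| ^ k = #|F|.-1 * r + 1)%N.
  by rewrite -predn_exp addn1 prednK // expn_gt0 (ltn_trans _ q2).
have {}cardB : #|B| = (#|F| * r + 1)%N.
  rewrite cardB -cardF !subn1 predn_exp mulKn -?subn1 ?subn_gt0 ?(ltn_trans _ q2) //.
  by rewrite big_ord_recl addnC big_distrr; congr addn; apply: eq_bigr => i _; rewrite expnS.
have [P [P1 PM PH nt]] := PSL_perm_hom k1 two isoH.
have Ptrans := SL_perm_transitive k1 q2 two Qr cardB P1 PM nt.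
have [K [iota [zeta [zp z1]]]] := extension_F2_root pp oddp.
have [psi psiP] := additive_char_exists pF zp z1.
apply: (SL_QB_very_simple P1 PM Ptrans k1 two oddF Qr cardB iota psiP) => A dA.
by apply: (subsetP sHG); apply: PH.
Qed.
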